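(* Let $1<p\le2$, $p'=p/(p-1)$, and $p\le b\le p'$. Assume $\sup_{\xi}\|v_\xi\|_{L^\infty(\overline{M})}/\|u_\xi\|_{L^\infty(\overline{M})}<\infty$. Let $\varphi$ be a positive function on $\mathcal{I}$ with $M_\varphi:=\sup_{t>0}t\sum_{\xi:\,t\le\varphi(\xi)}\|u_\xi\|^2_{L^\infty(\overline{M})}<\infty$. Then for every $f\in L^p(\overline{M})$, $$\Big(\sum_{\xi\in\mathcal{I}}\big(|\mathcal{F}_Lf(\xi)|\,\varphi(\xi)^{\frac1b-\frac1{p'}}\big)^b\,\|u_\xi\|_{L^\infty(\overline{M})}^{1-\frac{b}{p'}}\,\|v_\xi\|_{L^\infty(\overline{M})}^{1-\frac{b}{p}}\Big)^{1/b}\lesssim_p M_\varphi^{\frac1b-\frac1{p'}}\|f\|_{L^p(\overline{M})}.$$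
   Context: Standing setup: $\overline{M}$ is a smooth orientable manifold with (possibly empty) boundary and smooth density $dx$. $L$ is a pseudo-differential operator on its interior with boundary conditions giving discrete spectrum $\{\lambda_\xi\}_{\xi\in\mathcal{I}}$, eigenfunctions $u_\xi$ of $L$ and $v_\xi$ of $L^*$ ($L^*v_\xi=\overline{\lambda_\xi}v_\xi$), $\|u_\xi\|_{L^2}=\|v_\xi\|_{L^2}=1$, $(u_\xi,v_\eta)_{L^2}=\delta_{\xi\eta}$, $\{u_\xi\}$ a Riesz basis of $L^2(\overline{M})$, $u_\xi,v_\xi\in L^\infty$. $\mathcal{F}_Lf(\xi):=\int_{\overline{M}}f(x)\overline{v_\xi(x)}\,dx$. *)

(* Defs.v *)
From HB Require Import structures.
From mathcomp Require Import all_boot all_order all_algebra.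
From mathcomp Require Import all_classical all_reals all_analysis.
From mathcomp Require Import complex.
Set Implicit Arguments. Unset Strict Implicit. Unset Printing Implicit Defensive.
Import Order.TTheory GRing.Theory Num.Theory.
Local Open Scope classical_set_scope.
Local Open Scope ring_scope.

Definition cmod {R : realType} (z : R[i]) : R := ComplexField.Normc.normc z.

Section Defs.
Context {d : measure_display} {T : measurableType d} {R : realType}.
Variable mu : {measure set T -> \bar R}.

Definition cabs (f : T -> R[i]) : T -> \bar R := fun x => (cmod (f x))%:E.

Definition cmeasurable (f : T -> R[i]) : Prop :=
  measurable_fun setT (fun x => complex.Re (f x)) /\ measurable_fun setT (fun x => complex.Im (f x)).

Definition cLnorm (q : \bar R) (f : T -> R[i]) : \bar R := Lnorm mu q (cabs f).

Definition inLp (q : \bar R) (f : T -> R[i]) : Prop :=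
  cmeasurable f /\ (cLnorm q f < +oo)%E.

Definition cintegral (g : T -> R[i]) : R[i] :=
  Complex (Rintegral mu setT (fun x => complex.Re (g x)))
          (Rintegral mu setT (fun x => complex.Im (g x))).

Definition cinner (f g : T -> R[i]) : R[i] :=
  cintegral (fun x => f x * conjc (g x)).

Definition lincomb {I : Type} (u : I -> T -> R[i]) (s : seq I) (c : I -> R[i])
  : T -> R[i] := fun x => \sum_(xi <- s) c xi * u xi x.

Definition riesz_basis {I : eqType} (u : I -> T -> R[i]) : Prop :=
  (exists A B : R, 0 < A /\ 0 < B /\
     forall (s : seq I) (c : I -> R[i]), uniq s ->
       ((A * \sum_(xi <- s) cmod (c xi) ^+ 2)%:E
          <= \int[mu]_x ((cmod (lincomb u s c x)) ^+ 2)%:E)%E /\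
       (\int[mu]_x ((cmod (lincomb u s c x)) ^+ 2)%:E
          <= (B * \sum_(xi <- s) cmod (c xi) ^+ 2)%:E)%E) /\
  (forall f : T -> R[i], inLp 2%:E f -> forall eps : R, 0 < eps ->
     exists (s : seq I) (c : I -> R[i]),
       (cLnorm 2%:E (fun x => (f x - lincomb u s c x)%R) < eps%:E)%E).

Definition FL {I : Type} (v : I -> T -> R[i]) (f : T -> R[i]) (xi : I) : R[i] :=
  cinner f (v xi).

Definition Mphi {I : choiceType} (u : I -> T -> R[i]) (phi : I -> R) : \bar R :=
  ereal_sup [set (t%:E * \esum_(xi in [set xi | (t <= phi xi)%R])
                    (cLnorm +oo%E (u xi) * cLnorm +oo%E (u xi)))%E
            | t in [set t : R | 0 < t]].

End Defs.

(* Main.v *)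
Require Import Defs.
From HB Require Import structures.
From mathcomp Require Import all_boot all_order all_algebra.
From mathcomp Require Import all_classical all_reals all_analysis.
From mathcomp Require Import measurable_realfun ess_sup_inf.
From mathcomp Require Import complex.
From mathcomp Require Import ring lra.
Import Order.TTheory GRing.Theory Num.Theory.
Local Open Scope classical_set_scope.
Local Open Scope ring_scope.

(** Write [a], [U], [V] for [|F_L f|] and the sup norms of [u], [v], and [q] for
    [p']. With [b = al p + be q], [al + be = 1], the general summand is
    [(a^p (phi U)^(2-p))^al (a^q V^(2-q))^be], so Hoelder's inequality reduces the
    claim to [b = p] (Paley) and [b = q] (Hausdorff-Young). Both are Marcinkiewicz
    interpolations of the Bessel inequality, which follows from the Riesz basis
    property: for [a/(phi U)] and the weight [(phi U)^2], whose other endpoint is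
    the weak (1,1) bound given by [M_phi], and for [a/V] and the weight [V^2],
    whose other endpoint is the trivial L^1 -> l^oo bound. Since the sum over [I]
    is a supremum of finite sums, the layer-cake integrals can be replaced by
    finite sums over dyadic levels. The case [p = 2] is the Bessel inequality. *)

(** * Dyadic decompositions *)

Section Dyadic.
Set Implicit Arguments.
Unset Strict Implicit.
Context {R : realType}.
Implicit Types (x l q Y : R) (n : nat).

(** For p < 2 a function in L^p need not be in L^2, so its coefficients are estimated after a cut at
    some height: the large values lie in L^1 and meet the bounded [v], the small ones lie in L^2 and
    meet the Bessel inequality. The height must move with the level. For Paley it is M_phi times the
    level, which makes both pieces scale alike. For Hausdorff-Young it is a negative power of the
    level, chosen so that the L^1 piece is too small to matter on the level set. Summed over dyadic
    levels, the pieces give geometric series at each point, of ratios 2^-(p-1), 2^-(2-p) and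
    2^-(q-2); the last two degenerate at p = 2, hence the separate case. One constant C >= 1 serves
    both endpoints: Hoelder returns C^al C^be = C, and C^(1/b) <= C, so the result is uniform in b.
    The estimates divide by M_phi and by the norm of f, so a vanishing norm is treated apart. *)

Lemma dyadic_level x l n : l <= x -> x < l * 2 ^+ n ->
  exists2 i, (i < n)%N & l * 2 ^+ i <= x < l * 2 ^+ i.+1.
Proof.
move=> lx; elim: n => [|n IH xn]; first by rewrite expr0 mulr1 ltNge lx.
have [/IH [i ilt ix]|nx] := ltP x (l * 2 ^+ n).
  by exists i => //; exact: leqW.
by exists n; rewrite ?nx.
Qed.

Lemma seq_positive_bounds {I : eqType} (s : seq I) (x : I -> R) :
  exists l B, 0 < l /\ forall xi, xi \in s -> 0 < x xi -> l <= x xi <= B.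
Proof.
elim: s => [|a s [l [B [l0 IH]]]]; first by exists 1, 1; split.
have [xa|xa] := ltP 0 (x a); last first.
  exists l, B; split=> // xi; rewrite inE => /orP[/eqP ->|]; last exact: IH.
  by rewrite ltNge xa.
exists (Num.min l (x a)), (Num.max B (x a)); split; first by rewrite lt_min l0.
move=> xi; rewrite inE ge_min le_max => /orP[/eqP -> _|xis x0].
  by rewrite !lexx !orbT.
by have /andP[-> ->] := IH _ xis x0.
Qed.

Lemma dyadic_range {I : eqType} (s : seq I) (x : I -> R) :
  exists l n, 0 < l /\
    forall xi, xi \in s -> 0 < x xi -> l <= x xi < l * 2 ^+ n.
Proof.
have [l [B [l0 H]]] := seq_positive_bounds s x.
(* With k the Archimedean bound of B / l, the number of levels suffices because B / l < k < 2^k. *)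
exists l, (Num.bound (B / l)); split => // xi xis x0.
have /andP[-> xB] := H _ xis x0.
apply: (le_lt_trans xB); rewrite -ltr_pdivrMl//.
have [B0|B0] := leP B 0.
  apply: (@le_lt_trans _ _ 0); last exact: exprn_gt0.
  by rewrite pmulr_rle0 ?invr_gt0.
apply: (@lt_trans _ _ (Num.bound (B / l))%:R).
  by rewrite mulrC archi_boundP// divr_ge0 ?ltW.
by rewrite -natrX ltr_nat ltn_expl.
Qed.

(** After the sums are exchanged, the one level with l 2^i <= x < l 2^(i+1) already pays for x^q, at
    the cost of 2^q; the other levels are nonnegative. Zero values of [x] contribute nothing as q >
    0. *)
Lemma dyadic_layer_cake {I : eqType} (s : seq I) (x w : I -> R) q :
  0 < q -> (forall xi, 0 <= x xi) -> (forall xi, 0 <= w xi) ->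
  exists l n, 0 < l /\
    \sum_(xi <- s) x xi `^ q * w xi
    <= 2 `^ q * \sum_(i < n) (l * 2 ^+ i) `^ q *
         \sum_(xi <- s | l * 2 ^+ i <= x xi) w xi.
Proof.
move=> q0 x0 w0; have [l [n [l0 H]]] := dyadic_range s x.
exists l, n; split => //.
under [X in _ * X]eq_bigr do rewrite mulr_sumr big_mkcond/=.
rewrite exchange_big/= mulr_sumr !big_seq ler_sum// => xi xis.
have [xi0|] := ltP 0 (x xi); last first.
  move=> xi0; have -> : x xi = 0 by apply/eqP; rewrite eq_le xi0 x0.
  rewrite powR0 ?gt_eqF// mul0r mulr_ge0 ?powR_ge0// sumr_ge0// => i _.
  by case: ifP => // _; rewrite mulr_ge0 ?powR_ge0.
have /andP[lx xn] := H _ xis xi0.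
have [i ilt /andP[ix xi1]] := dyadic_level lx xn.
rewrite (bigD1 (Ordinal ilt))//= ix mulrDr; apply: ler_wpDr.
  rewrite mulr_ge0 ?powR_ge0// sumr_ge0// => j _.
  by case: ifP => // _; rewrite mulr_ge0 ?powR_ge0.
have li0 : 0 <= l * 2 ^+ i by rewrite mulr_ge0 ?exprn_ge0 ?ltW.
rewrite mulrA ler_wpM2r// -powRM//.
apply: ge0_ler_powR; rewrite ?nnegrE ?mulr_ge0// ltW//.
by rewrite mulrCA -exprS.
Qed.

(** The sum of the geometric series of ratio 2^(-q); its fixed-point equation [geoCE] closes the
    inductions below. *)
Definition geoC q : R := (1 - 2 `^ (- q))^-1.

Lemma powR2N_lt1 q : 0 < q -> 2 `^ (- q) < 1 :> R.
Proof.
move=> q0; rewrite powRN invf_lt1 ?powR_gt0//.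
rewrite /powR pnatr_eq0 expR_gt1 mulr_gt0// ln_gt0//.
by rewrite ltr1n.
Qed.

Lemma geoC_gt0 q : 0 < q -> 0 < geoC q.
Proof. by move=> q0; rewrite invr_gt0 subr_gt0 powR2N_lt1. Qed.

Lemma geoC_ge0 q : 0 < q -> 0 <= geoC q.
Proof. by move=> q0; exact/ltW/geoC_gt0. Qed.

Lemma geoCE q : 0 < q -> geoC q * 2 `^ (- q) + 1 = geoC q.
Proof.
move=> q0; have /lt0r_neq0 := geoC_gt0 q0; rewrite invr_eq0 => h.
by rewrite /geoC; field.
Qed.

Lemma geoC1 : geoC 1 = 2.
Proof.
rewrite /geoC powR_inv1//; have -> : 1 - 2^-1 = 2^-1 :> R by lra.
exact: invrK.
Qed.

Lemma geometric_head q l n : 0 < q -> 0 < l ->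
  \sum_(i < n.+1) (l * 2 ^+ i) `^ q <= geoC q * (l * 2 ^+ n) `^ q.
Proof.
move=> q0 l0; elim: n => [|n IH].
  rewrite big_ord1 ler_peMl ?powR_ge0// -geoCE// lerDr.
  by rewrite mulr_ge0 ?powR_ge0// geoC_ge0.
rewrite big_ord_recr/=.
rewrite -[X in _ <= X * _]geoCE// mulrDl mul1r lerD2r.
apply: (le_trans IH); rewrite -mulrA ler_wpM2l ?geoC_ge0//.
have ln0 : 0 <= l * 2 ^+ n by rewrite mulr_ge0 ?exprn_ge0 ?ltW.
rewrite exprS mulrCA (powRM _ _ ln0)//.
by rewrite mulrA -powRD ?addNr ?powRr0 ?mul1r// pnatr_eq0 implybT.
Qed.

(** The induction leaves [l] free: removing the first term leaves the same sum started at 2 l. *)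
Lemma geometric_tail q l n : 0 < q -> 0 < l ->
  \sum_(i < n) (l * 2 ^+ i) `^ (- q) <= geoC q * l `^ (- q).
Proof.
move=> q0; elim: n l => [|n IH] l l0.
  by rewrite big_ord0 mulr_ge0 ?powR_ge0// geoC_ge0.
rewrite big_ord_recl/= expr0 mulr1.
rewrite -[X in _ <= X * _]geoCE// mulrDl mul1r addrC lerD2r.
rewrite -mulrA -powRM ?(ltW l0)//.
under eq_bigr do rewrite /bump/= add1n exprS mulrCA mulrA.
by apply: IH; rewrite mulr_gt0.
Qed.

Lemma geometric_below q l n Y : 0 < q -> 0 < l -> 0 <= Y ->
  \sum_(i < n | l * 2 ^+ i <= Y) (l * 2 ^+ i) `^ q <= geoC q * Y `^ q.
Proof.
move=> q0 l0 Y0; elim: n => [|n IH].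
  by rewrite big_ord0 mulr_ge0 ?powR_ge0// geoC_ge0.
have [nY|nY] := leP (l * 2 ^+ n) Y; last first.
  by rewrite big_mkcond big_ord_recr/= (lt_geF nY) addr0 -big_mkcond.
apply: (@le_trans _ _ (\sum_(i < n.+1) (l * 2 ^+ i) `^ q)).
  by rewrite big_mkcond; apply: ler_sum => i _; case: ifP => // _; exact: powR_ge0.
apply: (le_trans (geometric_head _ q0 l0)).
rewrite ler_wpM2l ?geoC_ge0//.
have ln0 : 0 <= l * 2 ^+ n by rewrite mulr_ge0 ?exprn_ge0 ?ltW.
by apply: ge0_ler_powR; rewrite ?nnegrE// ltW.
Qed.

Lemma geometric_above q l n Y : 0 < q -> 0 < l -> 0 < Y ->
  \sum_(i < n | Y <= l * 2 ^+ i) (l * 2 ^+ i) `^ (- q) <= geoC q * Y `^ (- q).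
Proof.
move=> q0 + Y0; elim: n l => [|n IH] l l0.
  by rewrite big_ord0 mulr_ge0 ?powR_ge0// geoC_ge0.
have [nY|nY] := leP Y l; last first.
  rewrite big_mkcond big_ord_recl/= expr0 mulr1 (lt_geF nY) add0r.
  under eq_bigr do rewrite /bump/= add1n exprS mulrA.
  by rewrite -big_mkcond; apply: IH; rewrite mulr_gt0.
apply: (@le_trans _ _ (\sum_(i < n.+1) (l * 2 ^+ i) `^ (- q))).
  by rewrite big_mkcond; apply: ler_sum => i _; case: ifP => // _; exact: powR_ge0.
apply: (le_trans (geometric_tail _ q0 l0)).
rewrite ler_wpM2l ?geoC_ge0// !powRN lef_pV2 ?posrE ?powR_gt0//.
by apply: ge0_ler_powR; rewrite ?nnegrE//; exact: ltW.
Qed.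

End Dyadic.

(** * Marcinkiewicz interpolation for finite sums *)

Section Interpolation.
Set Implicit Arguments.
Unset Strict Implicit.
Context {R : realType} {I : eqType}.
Implicit Types (s : seq I).

(** Weights 0 are allowed because they occur at the endpoints b = p and b = q. *)
Lemma powR_young (x y al be : R) : 0 <= x -> 0 <= y -> 0 <= al -> 0 <= be ->
  al + be = 1 -> x `^ al * y `^ be <= al * x + be * y.
Proof.
move=> x0 y0; rewrite le_eqVlt => /predU1P[<-|al0].
  by rewrite add0r => be0 ->; rewrite powRr0 powRr1// mul0r add0r.
rewrite le_eqVlt => /predU1P[<-|be0].
  by rewrite addr0 => ->; rewrite powRr0 powRr1// mul0r addr0 mulr1 mul1r.
move=> ab; have := @conjugate_powR R (x `^ al) (y `^ be) al^-1 be^-1.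
rewrite !invrK !invr_gt0 !powR_ge0 => /(_ isT isT al0 be0 ab).
rewrite -!powRrM !divff ?gt_eqF// !powRr1//.
by rewrite (mulrC x) (mulrC y).
Qed.

(** Young's inequality applied to F / X and G / Y and summed; upper bounds X, Y of the two sums
    serve as well as the sums themselves. *)
Lemma sum_powR_holder s (F G : I -> R) (X Y al be : R) :
  (forall xi, 0 <= F xi) -> (forall xi, 0 <= G xi) -> 0 < X -> 0 < Y ->
  0 <= al -> 0 <= be -> al + be = 1 ->
  \sum_(xi <- s) F xi <= X -> \sum_(xi <- s) G xi <= Y ->
  \sum_(xi <- s) F xi `^ al * G xi `^ be <= X `^ al * Y `^ be.
Proof.
move=> F0 G0 X0 Y0 al0 be0 ab FX GY.
have XY0 : 0 <= X `^ al * Y `^ be by rewrite mulr_ge0 ?powR_ge0.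
apply: (@le_trans _ _ (\sum_(xi <- s) X `^ al * Y `^ be *
    (al * (F xi / X) + be * (G xi / Y)))).
  apply: ler_sum => xi _.
  have -> : F xi `^ al * G xi `^ be
      = X `^ al * Y `^ be * ((F xi / X) `^ al * (G xi / Y) `^ be).
    rewrite mulrACA -!powRM ?divr_ge0 ?(ltW X0) ?(ltW Y0)//.
    by rewrite !(mulrC _ (_ / _)) !divfK ?gt_eqF.
  by rewrite ler_wpM2l// powR_young// divr_ge0// ltW.
rewrite -mulr_sumr ler_piMr// big_split/= -!mulr_sumr -!mulr_suml.
rewrite -ab lerD// ler_piMr// ler_pdivrMr// mul1r//.
Qed.

(* weak type (1,1) input of Paley's inequality *)
Lemma sum_sqr_sublevel s (phi W : I -> R) (M : R) :
  (forall xi, 0 < phi xi) -> (forall xi, 0 <= W xi) -> 0 <= M ->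
  (forall t, 0 < t -> t * \sum_(xi <- s | t <= phi xi) W xi <= M) ->
  forall y, 0 <= y ->
  \sum_(xi <- s | phi xi <= y) phi xi ^+ 2 * W xi <= 8 * M * y.
Proof.
move=> phi0 W0 M0 HM y y0.
(* Truncating at y empties every dyadic level above y. *)
pose x xi := if phi xi <= y then phi xi else 0.
have x0 xi : 0 <= x xi by rewrite /x; case: ifP => // _; exact: ltW.
have [l [n [l0 H]]] := @dyadic_layer_cake R I s x W 2 ltac:(lra) x0 W0.
have -> : \sum_(xi <- s | phi xi <= y) phi xi ^+ 2 * W xi =
    \sum_(xi <- s) x xi `^ 2 * W xi.
  rewrite big_mkcond; apply: eq_bigr => xi _; rewrite powR_mulrn// /x.
  by case: ifP; rewrite // expr0n mul0r.
apply: (le_trans H).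
(* A level t = l 2^i <= y carries t^2 times a mass of at most M / t, that is M t. These add up to at
   most 2 M y, so the constant is 8 = 2^2 * 2. *)
apply: (@le_trans _ _ (2 `^ 2 *
  \sum_(i < n | l * 2 ^+ i <= y) M * (l * 2 ^+ i) `^ 1)).
  rewrite ler_wpM2l ?powR_ge0// [leRHS]big_mkcond/=; apply: ler_sum => i _.
  have li0 : 0 < l * 2 ^+ i by rewrite mulr_gt0// exprn_gt0.
  have lei xi : (l * 2 ^+ i <= x xi) = (l * 2 ^+ i <= phi xi) && (phi xi <= y).
    by rewrite /x; case: ifP; rewrite ?andbT// andbF (lt_geF li0).
  under eq_bigl do rewrite lei.
  case: ifPn => [liy|]; last first.
    rewrite -ltNge => yli; rewrite big_pred0 ?mulr0// => xi.
    by apply/negbTE/negP => /andP[/le_trans/[apply]]; rewrite (lt_geF yli).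
  rewrite powRr1 ?(ltW li0)// powR_mulrn ?(ltW li0)// expr2 -mulrA (mulrC M).
  rewrite ler_wpM2l ?(ltW li0)//; apply: le_trans (HM _ li0).
  rewrite ler_wpM2l ?(ltW li0)// big_mkcondr/=; apply: ler_sum => xi _.
  by case: ifP.
rewrite powR_mulrn// -mulr_sumr.
have := geometric_below n (@ltr01 R) l0 y0.
rewrite geoC1 powRr1// => H'.
apply: (@le_trans _ _ (2 ^+ 2 * (M * (2 * y)))).
  by rewrite ler_wpM2l// ler_wpM2l.
by rewrite le_eqVlt; apply/orP; left; apply/eqP; ring.
Qed.

Lemma powR_div_sqr (x y p : R) : 0 <= x -> 0 < y ->
  (x / y) `^ p * y ^+ 2 = x `^ p * y `^ (2 - p).
Proof.
move=> x0 y0; have y0' := ltW y0.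
rewrite powRM ?invr_ge0// -mulrA; congr (_ * _).
rewrite -powR_mulrn// -(powR_inv1 y0') -powRrM -powRD ?(gt_eqF y0) ?implybT//.
by congr (_ `^ _); ring.
Qed.

(* What is needed of [a xi = |F f xi|]: at each height [h], [f] is the sum of a
   part whose coefficients are controlled by its L^1 norm [E0 h], and a part
   whose coefficients are square summable with squared L^2 norm [E1 h]. *)
Definition splits_at_heights s (a V : I -> R) (A : R) (E0 E1 : R -> R) :=
  forall h, 0 < h -> exists a0 a1 : I -> R,
    [/\ forall xi, 0 <= a1 xi, forall xi, a xi <= a0 xi + a1 xi,
        forall xi, a0 xi <= 2 * V xi * E0 h &
        \sum_(xi <- s) a1 xi ^+ 2 <= A * E1 h].

Lemma paley_sum s (a U V phi : I -> R) (A : R) (E0 E1 : R -> R)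
    (p K M N c0 c1 : R) :
  1 < p ->
  (forall xi, 0 <= a xi) -> (forall xi, 0 < U xi) -> (forall xi, 0 < phi xi) ->
  0 < K -> (forall xi, V xi <= K * U xi) ->
  0 < M -> (forall t, 0 < t -> t * \sum_(xi <- s | t <= phi xi) U xi ^+ 2 <= M) ->
  0 <= A -> splits_at_heights s a V A E0 E1 -> (forall h, 0 <= E0 h) ->
  (forall l n, 0 < l ->
    \sum_(i < n) (l * 2 ^+ i) `^ (p - 1) * E0 (l * 2 ^+ i) <= c0 * N) ->
  (forall l n, 0 < l ->
    \sum_(i < n) (l * 2 ^+ i) `^ (p - 2) * E1 (l * 2 ^+ i) <= c1 * N) ->
  \sum_(xi <- s) a xi `^ p * (phi xi * U xi) `^ (2 - p)
  <= 2 `^ p * (32 * K * c0 + 4 * A * c1) * M `^ (2 - p) * N.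
Proof.
move=> p1 a_ge0 U0 phi0 K0 VU M0 HM A0 split E00 H0 H1.
have phiU0 xi : 0 < phi xi * U xi by rewrite mulr_gt0.
(* If phi <= 4 K E0 / lam, the sublevel bound gives 8 M times this threshold, hence 32. Otherwise V
   <= K U forces a0 below half of lam phi U, so a1 carries the other half and (phi U)^2 <= 4 a1^2 /
   lam^2. *)
have level (lam h : R) : 0 < lam -> 0 < h ->
    \sum_(xi <- s | lam <= a xi / (phi xi * U xi)) (phi xi * U xi) ^+ 2
    <= 32 * K * M * E0 h / lam + 4 * A * E1 h / lam ^+ 2.
  move=> lam0 h0; have [a0 [a1 [a10 aa ha0 ha1]]] := split h h0.
  have y0 : 0 <= 4 * K * E0 h / lam by rewrite !(mulr_ge0,invr_ge0) ?E00 ?ltW.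
  apply: (@le_trans _ _ (\sum_(xi <- s)
      ((if phi xi <= 4 * K * E0 h / lam then phi xi ^+ 2 * U xi ^+ 2 else 0)
       + 4 / lam ^+ 2 * a1 xi ^+ 2))).
    rewrite big_mkcond; apply: ler_sum => xi _.
    have t0 : 0 <= 4 / lam ^+ 2 * a1 xi ^+ 2.
      by rewrite mulr_ge0 ?divr_ge0 ?sqr_ge0.
    case: ifP => [|_]; last first.
      by rewrite addr_ge0//; case: ifP => // _; rewrite mulr_ge0 ?sqr_ge0.
    rewrite ler_pdivlMr// => lamx.
    case: ifPn => [_|]; first by rewrite exprMn lerDl.
    rewrite -ltNge add0r ltr_pdivrMr// => phibig.
    rewrite mulrAC ler_pdivlMr ?exprn_gt0//.
    have -> : 4 * a1 xi ^+ 2 = (2 * a1 xi) ^+ 2 by ring.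
    rewrite -exprMn lerXn2r ?nnegrE ?(mulr_ge0 _ (a10 xi))//.
      by rewrite mulr_ge0 ?ltW.
    have : 2 * (2 * V xi * E0 h) <= phi xi * lam * U xi.
      apply: (@le_trans _ _ (4 * K * E0 h * U xi)); last by rewrite ler_wpM2r ?ltW.
      have := ler_wpM2r (E00 h) (VU xi); lra.
    have := aa xi; have := ha0 xi; lra.
  rewrite big_split/= -mulr_sumr -big_mkcond/= lerD//.
    have sq0 xi : 0 <= U xi ^+ 2 by exact: sqr_ge0.
    apply: (le_trans (sum_sqr_sublevel phi0 sq0 (ltW M0) HM y0)).
    by rewrite le_eqVlt; apply/orP; left; apply/eqP; ring.
  rewrite [leRHS](_ : _ = 4 / lam ^+ 2 * (A * E1 h)); last by ring.
  by rewrite ler_wpM2l// divr_ge0 ?sqr_ge0.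
have x0 xi : 0 <= a xi / (phi xi * U xi) by rewrite divr_ge0// ltW.
have w0 xi : 0 <= (phi xi * U xi) ^+ 2 by exact: sqr_ge0.
have [l [n [l0 H]]] := dyadic_layer_cake s (lt_trans ltr01 p1) x0 w0.
have -> : \sum_(xi <- s) a xi `^ p * (phi xi * U xi) `^ (2 - p) =
    \sum_(xi <- s) (a xi / (phi xi * U xi)) `^ p * (phi xi * U xi) ^+ 2.
  by apply: eq_bigr => xi _; rewrite powR_div_sqr.
apply: (le_trans H); rewrite -!mulrA ler_wpM2l ?powR_ge0// !mulrA.
(* The height for level lam is M lam: M lam^(p-1) and lam^(p-2) are M^(2-p) times the same powers of
   M lam, so a common factor comes out and both sums run over dyadic heights starting at M l. *)
apply: (@le_trans _ _ (\sum_(i < n)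
   M `^ (2 - p) * (32 * K * ((M * l * 2 ^+ i) `^ (p - 1) * E0 (M * l * 2 ^+ i))
      + 4 * A * ((M * l * 2 ^+ i) `^ (p - 2) * E1 (M * l * 2 ^+ i))))).
  apply: ler_sum => i _.
  have lam0 : 0 < l * 2 ^+ i by rewrite mulr_gt0 ?exprn_gt0.
  move: (l * 2 ^+ i) lam0 (mulrA M l (2 ^+ i)) => lam lam0 <-.
  apply: (le_trans (ler_wpM2l (powR_ge0 _ _) (level _ _ lam0 (mulr_gt0 M0 lam0)))).
  have e1 : lam `^ p * lam^-1 * M = M `^ (2 - p) * (M * lam) `^ (p - 1).
    rewrite powRM ?ltW// mulrA -powRD ?(gt_eqF M0) ?implybT//.
    rewrite -powR_inv1 ?ltW// -powRD ?(gt_eqF lam0) ?implybT//.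
    have -> : 2 - p + (p - 1) = 1 by ring.
    by rewrite powRr1 ?(ltW M0)// mulrC.
  have e2 : lam `^ p / lam ^+ 2 = M `^ (2 - p) * (M * lam) `^ (p - 2).
    rewrite powRM ?ltW// mulrA -powRD ?(gt_eqF M0) ?implybT//.
    rewrite -(powR_mulrn _ (ltW lam0)) -powRN -powRD ?(gt_eqF lam0) ?implybT//.
    have -> : 2 - p + (p - 2) = 0 by ring.
    by rewrite powRr0 mul1r.
  rewrite le_eqVlt; apply/orP; left; apply/eqP.
  rewrite mulrDr [RHS]mulrDr; congr (_ + _).
    transitivity (lam `^ p * lam^-1 * M * (32 * K * E0 (M * lam))); first by ring.
    by rewrite e1; ring.
  transitivity (lam `^ p / lam ^+ 2 * (4 * A * E1 (M * lam))); first by ring.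
  by rewrite e2; ring.
rewrite -mulr_sumr big_split/= -!mulr_sumr.
rewrite [leRHS](_ : _ = M `^ (2 - p) * (32 * K * (c0 * N) + 4 * A * (c1 * N)));
  last by ring.
rewrite ler_wpM2l ?powR_ge0//.
by rewrite lerD// ler_wpM2l ?mulr_ge0 ?(ltW K0)//; [apply: H0|apply: H1]; rewrite mulr_gt0.
Qed.

Lemma hausdorff_young_sum s (a V : I -> R) (A : R) (E0 E1 : R -> R)
    (p q N c : R) :
  1 < p -> 0 < q ->
  (forall xi, 0 <= a xi) -> (forall xi, 0 < V xi) -> 0 < N ->
  0 <= A -> splits_at_heights s a V A E0 E1 ->
  (forall h, 0 < h -> E0 h <= h `^ (1 - p) * N) ->
  (forall l n, 0 < l ->
    \sum_(i < n) (l * 2 ^+ i) `^ (q - 2) * E1 ((l * 2 ^+ i) `^ (- (p - 1)^-1))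
    <= c * N) ->
  \sum_(xi <- s) a xi `^ q * V xi `^ (2 - q)
  <= 2 `^ q * (4 * A * 8 `^ (q - 2) * c) * N `^ (q - 1).
Proof.
move=> p1 q0 a_ge0 V0 N0 A0 split HE0 HE1.
have level (lam : R) : 0 < lam ->
    \sum_(xi <- s | lam <= a xi / V xi) V xi ^+ 2
    <= 4 * A * E1 ((lam / (8 * N)) `^ (- (p - 1)^-1)) / lam ^+ 2.
  (* This height solves h^(1-p) N = lam / 8, so a0 <= lam V / 4. On the level set a1 is then at
     least 3/4 of lam V, more than the half used below. *)
  move=> lam0; set h := _ `^ _.
  have lamN0 : 0 < lam / (8 * N) by rewrite divr_gt0 ?mulr_gt0.
  have h0 : 0 < h by rewrite powR_gt0.
  have hE : h `^ (1 - p) = lam / (8 * N).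
    rewrite -powRrM (_ : - (p - 1)^-1 * (1 - p) = 1) ?powRr1 ?(ltW lamN0)//.
    by field; lra.
  have [a0 [a1 [a10 aa ha0 ha1]]] := split h h0.
  apply: (@le_trans _ _ (\sum_(xi <- s) 4 / lam ^+ 2 * a1 xi ^+ 2)).
    rewrite big_mkcond; apply: ler_sum => xi _.
    case: ifP => [|_]; last by rewrite mulr_ge0 ?divr_ge0 ?sqr_ge0.
    rewrite ler_pdivlMr// => lamx.
    rewrite mulrAC ler_pdivlMr ?exprn_gt0//.
    have -> : 4 * a1 xi ^+ 2 = (2 * a1 xi) ^+ 2 by ring.
    rewrite -exprMn lerXn2r ?nnegrE ?(mulr_ge0 _ (a10 xi))//.
      by rewrite mulr_ge0 ?ltW.
    have : 2 * V xi * E0 h <= V xi * lam / 4.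
      have := ler_wpM2l (ltW (V0 xi)) (HE0 _ h0).
      have -> : h `^ (1 - p) * N = lam / 8 by rewrite hE; field; lra.
      lra.
    have := aa xi; have := ha0 xi; have := mulr_gt0 lam0 (V0 xi); lra.
  rewrite -mulr_sumr [leRHS](_ : _ = 4 / lam ^+ 2 * (A * E1 h)); last by ring.
  by rewrite ler_wpM2l// divr_ge0 ?sqr_ge0.
have x0 xi : 0 <= a xi / V xi by rewrite divr_ge0// ltW.
have w0 xi : 0 <= V xi ^+ 2 by exact: sqr_ge0.
have [l [n [l0 H]]] := dyadic_layer_cake s q0 x0 w0.
have -> : \sum_(xi <- s) a xi `^ q * V xi `^ (2 - q) =
    \sum_(xi <- s) (a xi / V xi) `^ q * V xi ^+ 2.
  by apply: eq_bigr => xi _; rewrite powR_div_sqr.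
apply: (le_trans H); rewrite -!mulrA ler_wpM2l ?powR_ge0// !mulrA.
have N80 : 0 < 8 * N by rewrite mulr_gt0.
(* In the variable lam / (8 N) the heights no longer involve N. The rescaling yields N^(q-2), and
   the sum of the E1 terms supplies one more N. *)
apply: (@le_trans _ _ (\sum_(i < n) (4 * A * (8 * N) `^ (q - 2)) *
    ((l / (8 * N) * 2 ^+ i) `^ (q - 2)
      * E1 ((l / (8 * N) * 2 ^+ i) `^ (- (p - 1)^-1))))).
  apply: ler_sum => i _.
  have lam0 : 0 < l * 2 ^+ i by rewrite mulr_gt0 ?exprn_gt0.
  move: (l * 2 ^+ i) lam0 (mulrAC l (2 ^+ i) (8 * N)^-1) => lam lam0 <-.
  apply: (le_trans (ler_wpM2l (powR_ge0 _ _) (level _ lam0))).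
  have e : lam `^ q / lam ^+ 2 = (8 * N) `^ (q - 2) * (lam / (8 * N)) `^ (q - 2).
    rewrite -powRM ?(ltW N80) ?divr_ge0 ?ltW//.
    rewrite mulrCA divff ?gt_eqF// mulr1.
    by rewrite -(powR_mulrn _ (ltW lam0)) -powRN -powRD ?(gt_eqF lam0) ?implybT.
  rewrite le_eqVlt; apply/orP; left; apply/eqP.
  set E := E1 _.
  transitivity (lam `^ q / lam ^+ 2 * (4 * A * E)); first by ring.
  by rewrite e; ring.
rewrite -mulr_sumr.
have -> : N `^ (q - 1) = N `^ (q - 2) * N.
  rewrite -[X in _ * X](powRr1 (ltW N0)) -powRD ?(gt_eqF N0) ?implybT//.
  by congr (_ `^ _); ring.
rewrite [leRHS](_ : _ = 4 * A * (8 `^ (q - 2) * N `^ (q - 2)) * (c * N)); last by ring.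
rewrite -powRM ?(ltW N0)// ler_wpM2l//.
  by rewrite !mulr_ge0 ?powR_ge0.
by apply: HE1; rewrite divr_gt0.
Qed.

End Interpolation.

(** * Complex-valued integrals *)

Section ComplexModulus.
Set Implicit Arguments.
Unset Strict Implicit.
Context {R : realType}.
Implicit Types z w : R[i].

Lemma cmodE z : cmod z = Num.sqrt (complex.Re z ^+ 2 + complex.Im z ^+ 2).
Proof. by case: z. Qed.

Lemma cmod_ge0 z : 0 <= cmod z.
Proof. by rewrite cmodE sqrtr_ge0. Qed.

Lemma sqr_cmod z : cmod z ^+ 2 = complex.Re z ^+ 2 + complex.Im z ^+ 2.
Proof. by rewrite cmodE sqr_sqrtr// addr_ge0 ?sqr_ge0. Qed.

Lemma cmodM z w : cmod (z * w) = cmod z * cmod w.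
Proof. exact: ComplexField.Normc.normcM. Qed.

Lemma cmodD z w : cmod (z + w) <= cmod z + cmod w.
Proof. exact: le_normcD. Qed.

Lemma cmod0 : cmod (0 : R[i]) = 0.
Proof. exact: ComplexField.Normc.normc0. Qed.

Lemma cmod_conj z : cmod (conjc z) = cmod z.
Proof. by case: z => a b; rewrite !cmodE/= sqrrN. Qed.

Lemma normr_Re_le z : `|complex.Re z| <= cmod z.
Proof. by rewrite cmodE -sqrtr_sqr ler_wsqrtr// lerDl sqr_ge0. Qed.

Lemma normr_Im_le z : `|complex.Im z| <= cmod z.
Proof. by rewrite cmodE -sqrtr_sqr ler_wsqrtr// lerDr sqr_ge0. Qed.

Lemma cmod_le z : cmod z <= `|complex.Re z| + `|complex.Im z|.
Proof.
rewrite -(@ler_pXn2r _ 2)// ?nnegrE ?cmod_ge0 ?addr_ge0//.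
rewrite sqr_cmod sqrrD !real_normK ?num_real// lerD2r lerDl.
by rewrite mulrn_wge0// mulr_ge0.
Qed.

Lemma sqr_cmodD_le z w : cmod (z + w) ^+ 2 <= 2 * cmod z ^+ 2 + 2 * cmod w ^+ 2.
Proof.
apply: (@le_trans _ _ ((cmod z + cmod w) ^+ 2)).
  by rewrite lerXn2r ?nnegrE ?addr_ge0 ?cmod_ge0 ?cmodD.
have := sqr_ge0 (cmod z - cmod w); rewrite !expr2; lra.
Qed.

Lemma ReD z w : complex.Re (z + w) = complex.Re z + complex.Re w.
Proof. by case: z; case: w. Qed.

Lemma ImD z w : complex.Im (z + w) = complex.Im z + complex.Im w.
Proof. by case: z; case: w. Qed.

Lemma ReM z w : complex.Re (z * w) =
  complex.Re z * complex.Re w - complex.Im z * complex.Im w.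
Proof. by case: z; case: w. Qed.

Lemma ImM z w : complex.Im (z * w) =
  complex.Re z * complex.Im w + complex.Im z * complex.Re w.
Proof. by case: z => a b; case: w => e f. Qed.

End ComplexModulus.

Section ComplexIntegral.
Set Implicit Arguments.
Unset Strict Implicit.
Context {d : measure_display} {T : measurableType d} {R : realType}.
Variable mu : {measure set T -> \bar R}.
Implicit Types (f g h : T -> R[i]) (r : T -> R).

Lemma cmeasurable_cmod f : cmeasurable f -> measurable_fun setT (cmod \o f).
Proof.
move=> [mr mi]; rewrite (_ : cmod \o f =
  (fun x => (complex.Re (f x) ^+ 2 + complex.Im (f x) ^+ 2) `^ 2^-1)); last first.
  by apply/funext => x/=; rewrite cmodE powR12_sqrt// addr_ge0 ?sqr_ge0.
apply: (measurableT_comp (measurable_powR _)).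
by apply: measurable_funD; apply: measurable_funX.
Qed.

Lemma cmeasurableD f g : cmeasurable f -> cmeasurable g ->
  cmeasurable (fun x => f x + g x).
Proof.
move=> [fr fi] [gr gi]; split.
  by under eq_fun do rewrite ReD; exact: measurable_funD.
by under eq_fun do rewrite ImD; exact: measurable_funD.
Qed.

Lemma cmeasurableM f g : cmeasurable f -> cmeasurable g ->
  cmeasurable (fun x => f x * g x).
Proof.
move=> [fr fi] [gr gi]; split.
  under eq_fun do rewrite ReM.
  by apply: measurable_funB; exact: measurable_funM.
under eq_fun do rewrite ImM.
by apply: measurable_funD; exact: measurable_funM.
Qed.

Lemma cmeasurable_cst (c : R[i]) : @cmeasurable d T R (fun=> c).
Proof. by split; exact: measurable_cst. Qed.

Lemma cmeasurable_conj f : cmeasurable f -> cmeasurable (fun x => conjc (f x)).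
Proof.
move=> [fr fi]; split.
  by rewrite (_ : (fun x => _) = (fun x => complex.Re (f x)))//;
    apply/funext => x; case: (f x).
rewrite (_ : (fun x => _) = (fun x => - complex.Im (f x))).
  exact: measurable_funN.
by apply/funext => x; case: (f x).
Qed.

Lemma cmeasurable_lincomb {I : Type} (u : I -> T -> R[i]) (s : seq I) (c : I -> R[i]) :
  (forall xi, cmeasurable (u xi)) -> cmeasurable (lincomb u s c).
Proof.
move=> mu_; elim: s => [|a s IH].
  rewrite (_ : lincomb _ _ _ = fun=> 0); first exact: cmeasurable_cst.
  by apply/funext => x; rewrite /lincomb big_nil.
rewrite (_ : lincomb _ _ _ = fun x => c a * u a x + lincomb u s c x).
  by apply: cmeasurableD => //; apply: cmeasurableM => //; exact: cmeasurable_cst.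
by apply/funext => x; rewrite /lincomb big_cons.
Qed.

Definition rintegrable r := mu.-integrable setT (EFin \o r).

Lemma rintegrable_dom r (g : T -> R) : measurable_fun setT r -> rintegrable g ->
  (forall x, `|r x| <= g x) -> rintegrable r.
Proof.
move=> mr ig rg; apply: (@le_integrable _ _ _ _ _ _ _ (EFin \o g)) => //.
  exact/measurable_EFinP.
by move=> x _ /=; rewrite lee_fin (le_trans (rg x))// ler_norm.
Qed.

Lemma rintegrableZ (k : R) r : rintegrable r -> rintegrable (fun x => k * r x).
Proof. by move=> ir; exact: (integrableZl measurableT k ir). Qed.

Lemma rintegrableD r (g : T -> R) : rintegrable r -> rintegrable g ->
  rintegrable (fun x => r x + g x).
Proof. by move=> ir ig; exact: (integrableD measurableT ir ig). Qed.

Lemma rintegrable_measurable r : rintegrable r -> measurable_fun setT r.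
Proof. by move=> /integrableP[/measurable_EFinP]. Qed.

Lemma rintegrable_sum {J : Type} (s : seq J) (F : J -> T -> R) :
  (forall j, rintegrable (F j)) -> rintegrable (fun x => \sum_(j <- s) F j x).
Proof.
move=> iF; rewrite /rintegrable.
rewrite (_ : EFin \o _ = fun x => (\sum_(j <- s) (F j x)%:E)%E).
  by apply: (@integrable_sum _ _ _ mu _ measurableT _ s xpredT (fun j x => (F j x)%:E)) => j _; exact: iF.
by apply/funext => x /=; rewrite sumEFin.
Qed.

Lemma Rintegral_sum {J : Type} (s : seq J) (F : J -> T -> R) :
  (forall j, rintegrable (F j)) ->
  Rintegral mu setT (fun x => \sum_(j <- s) F j x)
  = \sum_(j <- s) Rintegral mu setT (F j).
Proof.
move=> iF; elim: s => [|a s IH].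
  under eq_Rintegral do rewrite big_nil.
  by rewrite big_nil Rintegral_cst// mul0r.
under eq_Rintegral do rewrite big_cons.
rewrite big_cons -IH; apply: RintegralD => //; first exact: iF.
exact: rintegrable_sum.
Qed.

Lemma rintegrable_fin r : measurable_fun setT r -> (forall x, 0 <= r x) ->
  (\int[mu]_x (r x)%:E < +oo)%E -> rintegrable r.
Proof.
move=> mr r0 fin; apply/integrableP; split; first exact/measurable_EFinP.
by under eq_integral do rewrite /= ger0_norm//.
Qed.

Lemma EFin_Rintegral r : rintegrable r ->
  (Rintegral mu setT r)%:E = (\int[mu]_x (r x)%:E)%E.
Proof. by move=> ir; rewrite fineK//; exact: (integrable_fin_num measurableT ir). Qed.

(** [cintegral] is total; this is the condition under which its linearity is proved. *)
Definition cintegrable h := cmeasurable h /\ rintegrable (cmod \o h).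

Lemma cintegrable_Re h : cintegrable h -> rintegrable (fun x => complex.Re (h x)).
Proof.
move=> [[mr _] ih]; apply: rintegrable_dom mr ih _ => x.
exact: normr_Re_le.
Qed.

Lemma cintegrable_Im h : cintegrable h -> rintegrable (fun x => complex.Im (h x)).
Proof.
move=> [[_ mi] ih]; apply: rintegrable_dom mi ih _ => x.
exact: normr_Im_le.
Qed.

(** Real and imaginary parts are bounded separately. The resulting factor 2 is the one in
    [2 * V xi * E0 h] of [splits_at_heights]. *)
Lemma cmod_cintegral_le h : cintegrable h ->
  cmod (cintegral mu h) <= 2 * Rintegral mu setT (cmod \o h).
Proof.
move=> ch; apply: (le_trans (cmod_le _)); rewrite /cintegral/=.
have part r : rintegrable r -> (forall x, `|r x| <= cmod (h x)) ->
    `|Rintegral mu setT r| <= Rintegral mu setT (cmod \o h).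
  move=> ir rh; apply: (le_trans (le_normr_Rintegral measurableT ir)).
  apply: le_Rintegral => //; last exact: ch.2.
  exact: (integrable_norm ir).
have h1 := part _ (cintegrable_Re ch) (fun x => normr_Re_le _).
have h2 := part _ (cintegrable_Im ch) (fun x => normr_Im_le _).
lra.
Qed.

Lemma cintegralD f g : cintegrable f -> cintegrable g ->
  cintegral mu (fun x => f x + g x) = cintegral mu f + cintegral mu g.
Proof.
move=> cf cg; rewrite /cintegral.
under eq_Rintegral do rewrite ReD.
under [X in Complex _ X]eq_Rintegral do rewrite ImD.
by rewrite !RintegralD//; [exact: cintegrable_Im|exact: cintegrable_Im
  |exact: cintegrable_Re|exact: cintegrable_Re].
Qed.

Lemma cintegralZ (c : R[i]) f : cintegrable f ->
  cintegral mu (fun x => c * f x) = c * cintegral mu f.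
Proof.
move=> cf; have iR := cintegrable_Re cf; have iI := cintegrable_Im cf.
rewrite /cintegral; case: c => a b.
under eq_Rintegral do rewrite ReM/= -mulNr.
under [X in Complex _ X]eq_Rintegral do rewrite ImM/=.
rewrite !RintegralD ?RintegralZl//; do ?exact: rintegrableZ.
by rewrite mulNr.
Qed.

Lemma cintegrableD f g : cintegrable f -> cintegrable g ->
  cintegrable (fun x => f x + g x).
Proof.
move=> [mf If] [mg Ig]; split; first exact: cmeasurableD.
apply: rintegrable_dom (rintegrableD If Ig) _.
  by apply: cmeasurable_cmod; exact: cmeasurableD.
by move=> x; rewrite ger0_norm ?cmod_ge0// cmodD.
Qed.

Lemma cintegrableZ (c : R[i]) f : cintegrable f -> cintegrable (fun x => c * f x).
Proof.
move=> [mf If]; split; first by apply: cmeasurableM => //; exact: cmeasurable_cst.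
rewrite (_ : cmod \o _ = fun x => cmod c * (cmod \o f) x); first exact: rintegrableZ.
by apply/funext => x /=; rewrite cmodM.
Qed.

Definition square_integrable f :=
  cmeasurable f /\ rintegrable (fun x => cmod (f x) ^+ 2).

Lemma cintegrable_pairing_L2 f g : square_integrable f -> square_integrable g ->
  cintegrable (fun x => f x * conjc (g x)).
Proof.
move=> [mf If] [mg Ig].
have mm : cmeasurable (fun x => f x * conjc (g x)).
  by apply: cmeasurableM => //; exact: cmeasurable_conj.
split=> //; apply: rintegrable_dom (rintegrableD If Ig) _.
  exact: cmeasurable_cmod.
move=> x /=; rewrite ger0_norm ?cmod_ge0// cmodM cmod_conj.
have := sqr_ge0 (cmod (f x) - cmod (g x)); rewrite !expr2.
have := sqr_ge0 (cmod (f x)); have := sqr_ge0 (cmod (g x)); rewrite !expr2; lra.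
Qed.

(* The constant is not the one of Cauchy-Schwarz: only its finiteness matters. *)
Lemma cmod_cinner_le f g (t : R) : 0 < t ->
  square_integrable f -> square_integrable g ->
  cmod (cinner mu f g) <=
    t^-1 * Rintegral mu setT (fun x => cmod (f x) ^+ 2)
    + t * Rintegral mu setT (fun x => cmod (g x) ^+ 2).
Proof.
move=> t0 [mf If] [mg Ig].
have ci := cintegrable_pairing_L2 (conj mf If) (conj mg Ig).
apply: (le_trans (cmod_cintegral_le ci)).
rewrite -(RintegralZl 2 measurableT ci.2) -(RintegralZl t^-1 measurableT If).
rewrite -(RintegralZl t measurableT Ig).
rewrite -(RintegralD measurableT (rintegrableZ _ If) (rintegrableZ _ Ig)).
apply: le_Rintegral => //; first exact: (rintegrableZ 2 ci.2).
  by apply: rintegrableD; exact: rintegrableZ.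
move=> x _ /=; rewrite cmodM cmod_conj.
have : 0 <= t^-1 * (cmod (f x) - t * cmod (g x)) ^+ 2.
  by rewrite mulr_ge0 ?sqr_ge0// invr_ge0 ltW.
rewrite (_ : t^-1 * _ = t^-1 * cmod (f x) ^+ 2 + t * cmod (g x) ^+ 2
   - 2 * (cmod (f x) * cmod (g x))); first lra.
by field; lra.
Qed.

Lemma cinnerD f g h : cintegrable (fun x => f x * conjc (h x)) ->
  cintegrable (fun x => g x * conjc (h x)) ->
  cinner mu (fun x => f x + g x) h = cinner mu f h + cinner mu g h.
Proof.
move=> cf cg; rewrite -cintegralD//; congr cintegral.
by apply/funext => x; rewrite mulrDl.
Qed.

Lemma cintegrable_lincomb {I : Type} (u : I -> T -> R[i]) (s : seq I)
    (c : I -> R[i]) h :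
  (forall xi, cintegrable (fun x => u xi x * conjc (h x))) ->
  cintegrable (fun x => lincomb u s c x * conjc (h x)) /\
  cinner mu (lincomb u s c) h = \sum_(xi <- s) c xi * cinner mu (u xi) h.
Proof.
move=> ci; elim: s => [|a s [IHi IHs]].
  have lc0 : lincomb u [::] c = fun=> 0.
    by apply/funext => x; rewrite /lincomb big_nil.
  have e0 : (fun x => lincomb u [::] c x * conjc (h x)) = fun=> 0.
    by rewrite lc0; apply/funext => x; rewrite mul0r.
  rewrite /cinner e0 big_nil; split.
    split; first exact: cmeasurable_cst.
    rewrite (_ : _ \o _ = fun=> 0); first exact: integrable0.
    by apply/funext => x; exact: cmod0.
  by rewrite /cintegral/= !Rintegral_cst// !mul0r.
have e : (fun x => lincomb u (a :: s) c x * conjc (h x)) =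
    fun x => c a * (u a x * conjc (h x)) + lincomb u s c x * conjc (h x).
  by apply/funext => x; rewrite /lincomb big_cons mulrDl mulrA.
have cZ := cintegrableZ (c a) (ci a).
split; first by rewrite e; exact: cintegrableD.
by rewrite /cinner e cintegralD// cintegralZ// big_cons -IHs.
Qed.

End ComplexIntegral.

(** * Lebesgue norms, essential suprema and the L^1 - L^oo pairing *)

Section Norms.
Set Implicit Arguments.
Unset Strict Implicit.
Context {d : measure_display} {T : measurableType d} {R : realType}.
Variable mu : {measure set T -> \bar R}.
Implicit Types (f g h : T -> R[i]).

Lemma cLnormE (p : R) f :
  cLnorm mu p%:E f = ((\int[mu]_x (cmod (f x) `^ p)%:E) `^ p^-1)%E.
Proof.
rewrite /cLnorm Lnorm.unlock; congr (_ `^ _)%E; apply: eq_integral => x _ /=.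
by rewrite ger0_norm ?cmod_ge0.
Qed.

Lemma inLp_rintegrable (p : R) f : 0 < p -> inLp mu p%:E f ->
  rintegrable mu (fun x => cmod (f x) `^ p) /\
  cLnorm mu p%:E f = (Rintegral mu setT (fun x => cmod (f x) `^ p) `^ p^-1)%:E.
Proof.
move=> p0 [mf]; rewrite cLnormE => fin.
have If : rintegrable mu (fun x => cmod (f x) `^ p).
  apply: rintegrable_fin => [|x|]; [|exact: powR_ge0|].
    exact: (measurableT_comp (measurable_powR _) (cmeasurable_cmod mf)).
  (* An infinite integral stays infinite under the power p^-1, which is nonzero. *)
  move: fin; case: (\int[mu]_x _)%E => [r _|/=|//]; first exact: ltry.
  by rewrite invr_eq0 (gt_eqF p0).
by split => //; rewrite -poweR_EFin EFin_Rintegral.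
Qed.

Lemma inLp2_square_integrable f : inLp mu 2%:E f -> square_integrable mu f /\
  cLnorm mu 2%:E f = (Num.sqrt (Rintegral mu setT (fun x => cmod (f x) ^+ 2)))%:E.
Proof.
move=> Lf; have [If ->] := inLp_rintegrable (ltr0Sn _ 1) Lf.
have E : (fun x => cmod (f x) `^ 2) = (fun x => cmod (f x) ^+ 2).
  by apply/funext => x; rewrite powR_mulrn ?cmod_ge0.
rewrite -E; split; first by split; [exact: Lf.1|rewrite -E].
by rewrite powR12_sqrt// Rintegral_ge0// => x _; exact: powR_ge0.
Qed.

(** The norm at infinity unfolds to the essential supremum when the space has positive measure; a
    function of unit L^2 norm guarantees this, by [cLnorm2_measure_gt0]. *)
Lemma cLnorm_oo_ae f : (0 < mu setT)%E -> (cLnorm mu +oo%E f < +oo)%E ->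
  \forall x \ae mu, cmod (f x) <= fine (cLnorm mu +oo%E f).
Proof.
move=> mu0 fin; have ge0 : (0 <= cLnorm mu +oo%E f)%E by exact: Lnorm_ge0.
have E : cLnorm mu +oo%E f = ess_sup mu (abse \o cabs f).
  by rewrite /cLnorm Lnorm.unlock mu0.
have := ess_sup_ge mu (abse \o cabs f); rewrite -E.
apply: filterS => x /=; rewrite ger0_norm ?cmod_ge0//.
by rewrite -[X in (_ <= X)%E]fineK ?ge0_fin_numE.
Qed.

(** A vanishing sup norm would make f zero almost everywhere, against its unit L^2 norm. Positivity
    permits division by U and V. *)
Lemma cLnorm_oo_gt0 f : inLp mu 2%:E f -> cLnorm mu 2%:E f = 1%E ->
  (cLnorm mu +oo%E f < +oo)%E -> 0 < fine (cLnorm mu +oo%E f).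
Proof.
move=> Lf n1 fin; rewrite lt_neqAle fine_ge0 ?andbT; last exact: Lnorm_ge0.
apply/eqP => f0.
have mf : measurable_fun setT (@cabs d T R f).
  by apply/measurable_EFinP; exact: cmeasurable_cmod Lf.1.
have Loo0 : cLnorm mu +oo%E f = 0%E.
  rewrite -[LHS]fineK -?f0// ge0_fin_numE//; exact: Lnorm_ge0.
have /(Lnorm_eq0_eq0 mf lt0y) ae0 := Loo0.
move: n1; rewrite cLnormE (_ : (\int[mu]_x _)%E = 0%E).
  by rewrite poweR0r ?invr_neq0// => /eqP; rewrite eq_sym onee_eq0.
rewrite -(integral0 mu setT); apply: ae_eq_integral => //.
  apply/measurable_EFinP.
  exact: (measurableT_comp (measurable_powR _) (cmeasurable_cmod Lf.1)).
apply: filterS ae0 => x /= /(_ I) + _ => /eqP; rewrite /cabs eqe => /eqP ->.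
by rewrite powR0.
Qed.

Lemma cLnorm2_measure_gt0 f : cmeasurable f -> cLnorm mu 2%:E f = 1%E -> (0 < mu setT)%E.
Proof.
move=> mf n1; rewrite lt0e measure_ge0 andbT; apply/eqP => mu0.
move: n1; rewrite cLnormE (_ : (\int[mu]_x _)%E = 0%E).
  by rewrite poweR0r ?invr_neq0// => /eqP; rewrite eq_sym onee_eq0.
apply: null_set_integral => //; apply/measurable_EFinP.
exact: (measurableT_comp (measurable_powR _) (cmeasurable_cmod mf)).
Qed.

Lemma cintegrable_pairing_oo f g (V : R) : cmeasurable f -> cmeasurable g ->
  rintegrable mu (cmod \o f) -> 0 <= V ->
  (\forall x \ae mu, cmod (g x) <= V) ->
  cintegrable mu (fun x => f x * conjc (g x)) /\
  cmod (cinner mu f g) <= 2 * V * Rintegral mu setT (cmod \o f).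
Proof.
move=> mf mg If V0 gV.
have mm : cmeasurable (fun x => f x * conjc (g x)).
  by apply: cmeasurableM => //; exact: cmeasurable_conj.
have le : (\int[mu]_x (cmod (f x * conjc (g x)))%:E <=
    \int[mu]_x (V * cmod (f x))%:E)%E.
  apply: ae_ge0_le_integral => //.
  - by move=> x _; rewrite lee_fin cmod_ge0.
  - exact/measurable_EFinP/cmeasurable_cmod.
  - by move=> x _; rewrite lee_fin mulr_ge0 ?cmod_ge0.
  - apply/measurable_EFinP; exact: rintegrable_measurable (rintegrableZ V If).
  - apply: filterS gV => x gx _; rewrite lee_fin cmodM cmod_conj mulrC.
    by rewrite ler_wpM2r// cmod_ge0.
have ci : cintegrable mu (fun x => f x * conjc (g x)).
  split=> //; apply: rintegrable_fin => [|x|].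
  - exact: cmeasurable_cmod.
  - exact: cmod_ge0.
  - apply: (le_lt_trans le); rewrite -(EFin_Rintegral (rintegrableZ V If)).
    exact: ltry.
split=> //; apply: (le_trans (cmod_cintegral_le ci)).
rewrite -mulrA ler_wpM2l// -(RintegralZl V measurableT If) -lee_fin.
by rewrite (EFin_Rintegral ci.2) (EFin_Rintegral (rintegrableZ V If)).
Qed.

(** Stands in for Fubini: with finitely many heights, the sum over heights may be estimated at each
    point before integrating. *)
Lemma sum_Rintegral_le {J : Type} (s : seq J) (k : J -> R) (F : J -> T -> R)
    (r : T -> R) (C : R) :
  (forall j, rintegrable mu (F j)) -> rintegrable mu r ->
  (forall x, \sum_(j <- s) k j * F j x <= C * r x) ->
  \sum_(j <- s) k j * Rintegral mu setT (F j) <= C * Rintegral mu setT r.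
Proof.
move=> iF ir le.
under eq_bigr => j _ do rewrite -(RintegralZl (k j) measurableT (iF j)).
rewrite -(Rintegral_sum s (fun j => rintegrableZ (k j) (iF j))).
rewrite -(RintegralZl C measurableT ir); apply: le_Rintegral => //.
  by apply: rintegrable_sum => j; exact: rintegrableZ.
exact: rintegrableZ.
Qed.

End Norms.

(** * The Bessel inequality *)

Section Bessel.
Set Implicit Arguments.
Unset Strict Implicit.
Context {d : measure_display} {T : measurableType d} {R : realType}.
Variable mu : {measure set T -> \bar R}.

(** Density may return a list with repetitions, whereas the Riesz bounds are stated for
    duplicate-free lists. *)
Lemma lincomb_undup {I : eqType} (u : I -> T -> R[i]) (s : seq I) (c : I -> R[i]) :
  exists c', lincomb u s c = lincomb u (undup s) c'.
Proof.
exists (fun xi => c xi *+ count_mem xi s); apply/funext => x.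
rewrite /lincomb -big_undup_iterop_count; apply: eq_bigr => xi _.
by rewrite mulrnAl.
Qed.

Lemma sum_mem_le {I : eqType} (s s' : seq I) (F : I -> R) :
  uniq s -> uniq s' -> (forall xi, 0 <= F xi) ->
  \sum_(xi <- s | xi \in s') F xi <= \sum_(xi <- s') F xi.
Proof.
move=> us us' F0; rewrite -big_filter.
rewrite (perm_big [seq xi <- s' | xi \in s]); last first.
  apply: uniq_perm; rewrite ?filter_uniq// => xi.
  by rewrite !mem_filter andbC.
rewrite big_filter big_mkcond; apply: ler_sum => xi _.
by case: ifP.
Qed.

(** Biorthogonality reads off the coefficients of a finite combination h of the [u], and the lower
    Riesz bound A controls them by the norm of h. A general g is h plus an error e of norm below
    eps; each coefficient of e is at most 2 eps, and since [s] is fixed, eps may tend to 0. Squaring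
    g = h + e and h = g - e costs 2 each time, whence 4 / A. *)
Lemma bessel {I : eqType} (u v : I -> T -> R[i]) :
  (forall xi, inLp mu 2%:E (u xi) /\ inLp mu 2%:E (v xi)) ->
  (forall xi, cLnorm mu 2%:E (v xi) = 1%E) ->
  (forall xi eta, cinner mu (u xi) (v eta) = (if xi == eta then 1 else 0)) ->
  riesz_basis mu u ->
  exists2 B : R, 0 <= B & forall g, square_integrable mu g ->
    forall s, uniq s ->
    \sum_(xi <- s) cmod (FL mu v g xi) ^+ 2
    <= B * Rintegral mu setT (fun x => cmod (g x) ^+ 2).
Proof.
move=> L2 v1 biorth [[A [B [A0 [B0 riesz]]]] dense].
have uL2 xi := (inLp2_square_integrable (L2 xi).1).1.
have vL2 xi := (inLp2_square_integrable (L2 xi).2).1.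
have vint xi : Rintegral mu setT (fun x => cmod (v xi x) ^+ 2) = 1.
  have := v1 xi; rewrite (inLp2_square_integrable (L2 xi).2).2 => -[].
  move=> /(congr1 (fun x => x ^+ 2)); rewrite expr1n sqr_sqrtr//.
  by apply: Rintegral_ge0 => x _; exact: sqr_ge0.
exists (4 / A); first by rewrite divr_ge0// ltW.
move=> g gL2 s us; set G := Rintegral _ _ _.
have key eps : 0 < eps -> \sum_(xi <- s) cmod (FL mu v g xi) ^+ 2 <=
    4 / A * G + eps ^+ 2 * (4 / A + 8 * (size s)%:R).
  move=> eps0.
  have gLp : inLp mu 2%:E g.
    split; first exact: gL2.1.
    rewrite cLnormE -(_ : (G%:E = \int[mu]_x (cmod (g x) `^ 2)%:E)%E) ?ltry//.
    rewrite (EFin_Rintegral gL2.2); apply: eq_integral => x _.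
    by rewrite powR_mulrn ?cmod_ge0.
  have [s0 [c0 gap0]] := dense g gLp eps eps0.
  have [c hE] := lincomb_undup u s0 c0; rewrite hE in gap0.
  move: (undup s0) (undup_uniq s0) gap0 => {hE} s' us' gap {c0 s0}.
  set h := lincomb u s' c in gap.
  pose e := fun x => g x - h x; rewrite -/e in gap.
  have mh : cmeasurable h by apply: cmeasurable_lincomb => xi; exact: (uL2 xi).1.
  have meas_opp f : cmeasurable f -> cmeasurable (fun x => - f x).
    move=> mf; rewrite (_ : (fun x => - f x) = (fun x => (-1) * f x)).
      by apply: cmeasurableM => //; exact: cmeasurable_cst.
    by apply/funext => x; rewrite mulN1r.
  have eLp : inLp mu 2%:E e.
    split; last exact: (lt_trans gap (ltry _)).
    by apply: cmeasurableD; [exact: gL2.1|exact: meas_opp].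
  have [eL2 eE] := inLp2_square_integrable eLp.
  set E := Rintegral mu setT (fun x => cmod (e x) ^+ 2) in eE.
  have E0 : 0 <= E by apply: Rintegral_ge0 => x _; exact: sqr_ge0.
  have Eeps : E <= eps ^+ 2.
    move: gap; rewrite eE lte_fin => gap.
    rewrite -(sqr_sqrtr E0) lerXn2r ?nnegrE ?sqrtr_ge0 ?(ltW gap)//.
    exact: ltW.
  have cmodN z : cmod (- z) = cmod z :> R by rewrite !cmodE; case: z => a b /=; rewrite !sqrrN.
  have hg : h = fun x => g x + (- e x).
    by apply/funext => x; rewrite /e opprB addrC subrK.
  have hle x : cmod (h x) ^+ 2 <= 2 * cmod (g x) ^+ 2 + 2 * cmod (e x) ^+ 2.
    by rewrite hg -(cmodN (e x)) sqr_cmodD_le.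
  have i2 := rintegrableD (rintegrableZ 2 gL2.2) (rintegrableZ 2 eL2.2).
  have hL2 : square_integrable mu h.
    split=> //; apply: rintegrable_dom i2 _.
      by apply: measurable_funX; exact: cmeasurable_cmod.
    by move=> x; rewrite ger0_norm ?sqr_ge0 ?hle.
  have Hle : Rintegral mu setT (fun x => cmod (h x) ^+ 2) <= 2 * G + 2 * E.
    rewrite /G /E -(RintegralZl 2 measurableT gL2.2) -(RintegralZl 2 measurableT eL2.2).
    rewrite -(RintegralD measurableT (rintegrableZ 2 gL2.2) (rintegrableZ 2 eL2.2)).
    by apply: le_Rintegral => //; exact: hL2.2.
  have Fh xi : FL mu v h xi = if xi \in s' then c xi else 0.
    have ci eta : cintegrable mu (fun x => u eta x * conjc (v xi x)).
      exact: cintegrable_pairing_L2.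
    rewrite /FL (cintegrable_lincomb _ _ ci).2.
    under eq_bigr do rewrite biorth.
    case: ifPn => [xis|xis].
      rewrite (bigD1_seq xi)//= eqxx mulr1 big1 ?addr0// => eta /negbTE ->.
      by rewrite mulr0.
    rewrite big_seq big1// => eta etas; case: eqP => [eq|_]; last by rewrite mulr0.
    by rewrite eq in etas; rewrite etas in xis.
  (* The parameter t = eps balances eps^-1 |e|^2 <= eps against eps |v|^2 = eps. *)
  have Fe xi : cmod (FL mu v e xi) <= 2 * eps.
    apply: (le_trans (cmod_cinner_le eps0 eL2 (vL2 xi))).
    rewrite vint mulr1 -/E.
    have : eps^-1 * E <= eps.
      by rewrite mulrC ler_pdivrMr// -expr2.
    lra.
  have Fg xi : FL mu v g xi = FL mu v h xi + FL mu v e xi.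
    rewrite /FL -cinnerD; do ?exact: cintegrable_pairing_L2.
    by congr cinner; apply/funext => x; rewrite /e addrC subrK.
  apply: (@le_trans _ _ (\sum_(xi <- s)
      (2 * cmod (FL mu v h xi) ^+ 2 + 2 * (2 * eps) ^+ 2))).
    apply: ler_sum => xi _; rewrite Fg (le_trans (sqr_cmodD_le _ _))// lerD2l.
    by rewrite ler_wpM2l// lerXn2r ?nnegrE ?cmod_ge0 ?mulr_ge0// ltW.
  rewrite big_split/= -mulr_sumr big_const_seq count_predT iter_addr_0 -[X in _ + X <= _]mulr_natr.
  have : \sum_(xi <- s) cmod (FL mu v h xi) ^+ 2 <= A^-1 * (2 * G + 2 * eps ^+ 2).
    apply: (@le_trans _ _ (\sum_(xi <- s | xi \in s') cmod (c xi) ^+ 2)).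
      rewrite [leRHS]big_mkcond; apply: ler_sum => xi _; rewrite Fh.
      by case: ifP => // _; rewrite cmod0 expr0n.
    apply: (le_trans (sum_mem_le us us' (fun xi => sqr_ge0 _))).
    rewrite ler_pdivlMl//.
    have := (riesz s' c us').1.
    rewrite -(EFin_Rintegral hL2.2) lee_fin => /le_trans; apply.
    by rewrite (le_trans Hle)// lerD2l ler_wpM2l.
  move=> H; have -> : 4 / A * G + eps ^+ 2 * (4 / A + 8 * (size s)%:R) =
    2 * (A^-1 * (2 * G + 2 * eps ^+ 2)) + 2 * (2 * eps) ^+ 2 * (size s)%:R by ring.
  by rewrite lerD2r ler_wpM2l.
apply/ler_addgt0Pr => t t0.
set D := 4 / A + 8 * (size s)%:R in key.
have D0 : 0 < D by rewrite ltr_pwDl ?divr_gt0// mulr_ge0.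
(* The bound 1 turns eps^2 into at most eps, and t / D makes the error at most t. *)
pose eps := Num.min 1 (t / D).
have eps0 : 0 < eps by rewrite lt_min ltr01 divr_gt0.
apply: (le_trans (key _ eps0)); rewrite lerD2l.
have e1 : eps <= 1 by rewrite ge_min lexx.
have e2 : eps <= t / D by rewrite ge_min lexx orbT.
rewrite -ler_pdivlMr// (le_trans _ e2)// expr2 ler_piMr// ltW//.
Qed.

End Bessel.

(** * Splitting a function at a height *)

Section Heights.
Set Implicit Arguments.
Unset Strict Implicit.
Context {d : measure_display} {T : measurableType d} {R : realType}.
Variable mu : {measure set T -> \bar R}.

Lemma powR_split (x r t : R) : 0 < x -> x `^ (r + t) = x `^ r * x `^ t.
Proof. by move=> x0; rewrite powRD// (gt_eqF x0) implybT. Qed.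

Lemma powR_above (p h y : R) : 1 <= p -> 0 < h -> h < y ->
  y <= h `^ (1 - p) * y `^ p.
Proof.
move=> p1 h0 hy; have y0 := lt_trans h0 hy.
rewrite -{1}(powRr1 (ltW y0)) -{1}(subrK p 1) powR_split// ler_wpM2r ?powR_ge0//.
rewrite -(opprB p 1) !powRN lef_pV2 ?posrE ?powR_gt0//.
by apply: ge0_ler_powR; rewrite ?nnegrE ?subr_ge0// ltW.
Qed.

Lemma powR_below (p h y : R) : p <= 2 -> 0 < p -> 0 <= y -> y <= h ->
  y ^+ 2 <= h `^ (2 - p) * y `^ p.
Proof.
move=> p2 p0; rewrite le_eqVlt => /predU1P[<- _|y0 yh].
  by rewrite expr0n powR0 ?gt_eqF// mulr0.
rewrite -(powR_mulrn _ (ltW y0)) -{1}(subrK p 2) powR_split//.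
rewrite ler_wpM2r ?powR_ge0//.
apply: ge0_ler_powR; rewrite ?nnegrE ?subr_ge0 ?(ltW y0)//.
exact: le_trans (ltW y0) yh.
Qed.

Definition high (f : T -> R[i]) (h : R) (x : T) := if cmod (f x) <= h then 0 else f x.
Definition low (f : T -> R[i]) (h : R) (x : T) := if cmod (f x) <= h then f x else 0.

Lemma high_low f h x : f x = high f h x + low f h x.
Proof. by rewrite /high /low; case: ifP; rewrite ?addr0 ?add0r. Qed.

Lemma cmod_high f h x : cmod (high f h x) = if cmod (f x) <= h then 0 else cmod (f x).
Proof. by rewrite /high; case: ifP => // _; exact: cmod0. Qed.

Lemma sqr_cmod_low f h x :
  cmod (low f h x) ^+ 2 = if cmod (f x) <= h then cmod (f x) ^+ 2 else 0.
Proof. by rewrite /low; case: ifP => // _; rewrite cmod0 expr0n. Qed.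

Variables (p : R) (f : T -> R[i]).
Hypotheses (p1 : 1 < p) (p2 : p <= 2) (mf : cmeasurable f)
  (If : rintegrable mu (fun x => cmod (f x) `^ p)).

Let p0 : 0 < p := lt_trans ltr01 p1.
Let N := Rintegral mu setT (fun x => cmod (f x) `^ p).

Lemma cmeasurable_cond (F G : T -> R[i]) (h : R) : cmeasurable F -> cmeasurable G ->
  cmeasurable (fun x => if cmod (f x) <= h then F x else G x).
Proof.
move=> [Fr Fi] [Gr Gi].
have mb : measurable_fun setT (fun x => cmod (f x) <= h).
  by apply: measurable_fun_ler; [exact: cmeasurable_cmod|exact: measurable_cst].
split.
  by under eq_fun do rewrite (fun_if (@complex.Re R)); exact: measurable_fun_ifT.
by under eq_fun do rewrite (fun_if (@complex.Im R)); exact: measurable_fun_ifT.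
Qed.

Lemma cmeasurable_high h : cmeasurable (high f h).
Proof. by apply: cmeasurable_cond => //; exact: cmeasurable_cst. Qed.

Lemma cmeasurable_low h : cmeasurable (low f h).
Proof. by apply: cmeasurable_cond => //; exact: cmeasurable_cst. Qed.

Lemma cmod_high_le h x : 0 < h ->
  cmod (high f h x) <= h `^ (1 - p) * cmod (f x) `^ p.
Proof.
move=> h0; rewrite cmod_high; case: (leP (cmod (f x)) h) => [_|hy].
  by rewrite mulr_ge0 ?powR_ge0.
by apply: powR_above => //; exact: ltW.
Qed.

Lemma sqr_cmod_low_le h x :
  cmod (low f h x) ^+ 2 <= h `^ (2 - p) * cmod (f x) `^ p.
Proof.
rewrite sqr_cmod_low; case: ifP => [yh|_]; last by rewrite mulr_ge0 ?powR_ge0.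
by apply: powR_below => //; exact: cmod_ge0.
Qed.

Lemma rintegrable_high h : 0 < h -> rintegrable mu (cmod \o high f h).
Proof.
move=> h0; apply: rintegrable_dom (rintegrableZ (h `^ (1 - p)) If) _.
  exact/cmeasurable_cmod/cmeasurable_high.
by move=> x /=; rewrite ger0_norm ?cmod_ge0// cmod_high_le.
Qed.

Lemma square_integrable_low h : square_integrable mu (low f h).
Proof.
split; first exact: cmeasurable_low.
apply: rintegrable_dom (rintegrableZ (h `^ (2 - p)) If) _.
  by apply: measurable_funX; exact/cmeasurable_cmod/cmeasurable_low.
by move=> x /=; rewrite ger0_norm ?sqr_ge0// sqr_cmod_low_le.
Qed.

Definition L1high h := Rintegral mu setT (cmod \o high f h).
Definition L2low h := Rintegral mu setT (fun x => cmod (low f h x) ^+ 2).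

Lemma L1high_ge0 h : 0 <= L1high h.
Proof. by apply: Rintegral_ge0 => x _; exact: cmod_ge0. Qed.

Lemma L1high_le h : 0 < h -> L1high h <= h `^ (1 - p) * N.
Proof.
move=> h0; rewrite -(RintegralZl _ measurableT If); apply: le_Rintegral => //.
- exact: rintegrable_high.
- exact: rintegrableZ.
- by move=> x _; exact: cmod_high_le.
Qed.

Lemma L2low_le h : L2low h <= h `^ (2 - p) * N.
Proof.
rewrite -(RintegralZl _ measurableT If); apply: le_Rintegral => //.
- exact: (square_integrable_low h).2.
- exact: rintegrableZ.
- by move=> x _; exact: sqr_cmod_low_le.
Qed.

(** Where |f| = y, only heights below y keep the value y. As p > 1, their powers (p-1) form a
    geometric sum of order y^(p-1), which leaves y^p. *)
Lemma sum_L1high (l : R) n : 0 < l ->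
  \sum_(i < n) (l * 2 ^+ i) `^ (p - 1) * L1high (l * 2 ^+ i) <= geoC (p - 1) * N.
Proof.
move=> l0; have li0 (i : 'I_n) : 0 < l * 2 ^+ i by rewrite mulr_gt0 ?exprn_gt0.
apply: (@sum_Rintegral_le _ _ _ mu 'I_n (index_enum 'I_n)
  (fun i : 'I_n => (l * 2 ^+ i) `^ (p - 1)) (fun i : 'I_n => cmod \o high f (l * 2 ^+ i))) => //.
  by move=> i; exact: rintegrable_high.
move=> x /=; set y := cmod (f x); have y0 : 0 <= y by exact: cmod_ge0.
apply: (@le_trans _ _ (\sum_(i < n | l * 2 ^+ i <= y) (l * 2 ^+ i) `^ (p - 1) * y)).
  rewrite [leRHS]big_mkcond; apply: ler_sum => i _; rewrite cmod_high -/y.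
  case: (leP y (l * 2 ^+ i)) => [_|/ltW ->//]; rewrite mulr0; case: ifP => // _.
  by rewrite mulr_ge0 ?powR_ge0.
rewrite -mulr_suml.
have [->|yn0] := eqVneq y 0; first by rewrite mulr0 powR0 ?gt_eqF// mulr0.
have yp : 0 < y by rewrite lt_def yn0.
rewrite -[X in y `^ X](subrK 1 p) powR_split// powRr1// mulrA ler_wpM2r//.
by apply: geometric_below; rewrite ?subr_gt0.
Qed.

(** Only heights of at least y keep y^2, and their powers p - 2 < 0 sum to order y^(p-2). *)
Lemma sum_L2low (l : R) n : p < 2 -> 0 < l ->
  \sum_(i < n) (l * 2 ^+ i) `^ (p - 2) * L2low (l * 2 ^+ i) <= geoC (2 - p) * N.
Proof.
move=> p2' l0.
apply: (@sum_Rintegral_le _ _ _ mu 'I_n (index_enum 'I_n)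
  (fun i : 'I_n => (l * 2 ^+ i) `^ (p - 2))
  (fun i : 'I_n => fun x => cmod (low f (l * 2 ^+ i) x) ^+ 2)) => //.
  by move=> i; exact: (square_integrable_low _).2.
move=> x /=; set y := cmod (f x); have y0 : 0 <= y by exact: cmod_ge0.
apply: (@le_trans _ _ (\sum_(i < n | y <= l * 2 ^+ i) (l * 2 ^+ i) `^ (p - 2) * y ^+ 2)).
  rewrite [leRHS]big_mkcond; apply: ler_sum => i _; rewrite sqr_cmod_low -/y.
  by case: ifP => // _; rewrite mulr0.
rewrite -mulr_suml.
have [->|yn0] := eqVneq y 0; first by rewrite expr0n mulr0 powR0 ?gt_eqF// mulr0.
have yp : 0 < y by rewrite lt_def yn0.
rewrite -[X in y `^ X](subrK 2 p) powR_split// powR_mulrn// mulrA ler_wpM2r ?sqr_ge0//.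
by rewrite -(opprB 2 p); apply: geometric_above; rewrite ?subr_gt0.
Qed.

(** Heights now decrease with the level: y is below the height exactly for levels up to y^(1-p). The
    powers q - 2 > 0 of these levels sum to order y^((1-p)(q-2)) = y^(p-2). *)
Lemma sum_L2low_conjugate (q l : R) n : p < 2 -> q = p / (p - 1) -> 0 < l ->
  \sum_(i < n) (l * 2 ^+ i) `^ (q - 2) * L2low ((l * 2 ^+ i) `^ (- (p - 1)^-1))
  <= geoC (q - 2) * N.
Proof.
move=> p2' qE l0.
have q2 : 0 < q - 2 by rewrite qE subr_gt0 ltr_pdivlMr ?subr_gt0//; lra.
apply: (@sum_Rintegral_le _ _ _ mu 'I_n (index_enum 'I_n)
  (fun i : 'I_n => (l * 2 ^+ i) `^ (q - 2))
  (fun i : 'I_n => fun x => cmod (low f ((l * 2 ^+ i) `^ (- (p - 1)^-1)) x) ^+ 2)) => //.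
  by move=> i; exact: (square_integrable_low _).2.
move=> x /=; set y := cmod (f x); have y0 : 0 <= y by exact: cmod_ge0.
have [yE|yn0] := eqVneq y 0.
  rewrite yE powR0 ?gt_eqF// mulr0 big1// => i _.
  by rewrite sqr_cmod_low -/y yE expr0n; case: ifP; rewrite mulr0.
have yp : 0 < y by rewrite lt_def yn0.
apply: (@le_trans _ _ (\sum_(i < n | l * 2 ^+ i <= y `^ (1 - p))
    (l * 2 ^+ i) `^ (q - 2) * y ^+ 2)).
  rewrite [leRHS]big_mkcond; apply: ler_sum => i _; rewrite sqr_cmod_low -/y.
  have li0 : 0 < l * 2 ^+ i by rewrite mulr_gt0 ?exprn_gt0.
  case: ifP => [yl|_]; last by rewrite mulr0; case: ifP => // _; rewrite mulr_ge0 ?powR_ge0 ?sqr_ge0.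
  suff -> : l * 2 ^+ i <= y `^ (1 - p) by [].
  have := ge0_ler_powR (ltW (_ : 0 < p - 1)) _ _ yl; rewrite subr_gt0 !nnegrE.
  move=> /(_ p1 y0 (powR_ge0 _ _)).
  rewrite -powRrM mulNr mulVf ?gt_eqF ?subr_gt0// powR_inv1 ?(ltW li0)//.
  rewrite -(opprB p 1) powRN => h.
  by rewrite -[leLHS]invrK lef_pV2 ?posrE ?invr_gt0 ?powR_gt0.
rewrite -mulr_suml.
have -> : y `^ p = (y `^ (1 - p)) `^ (q - 2) * y ^+ 2.
  rewrite -(powR_mulrn _ y0) -powRrM -powR_split//; congr (_ `^ _).
  by rewrite qE; field; rewrite gt_eqF ?subr_gt0.
rewrite mulrA ler_wpM2r ?sqr_ge0//.
exact: geometric_below (powR_ge0 _ _).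
Qed.

Lemma FL_splits {I : eqType} (v : I -> T -> R[i]) (s : seq I) (V : I -> R) (B : R) :
  (forall xi, square_integrable mu (v xi)) ->
  (forall xi, 0 <= V xi) ->
  (forall xi, \forall x \ae mu, cmod (v xi x) <= V xi) ->
  (forall g, square_integrable mu g -> \sum_(xi <- s) cmod (FL mu v g xi) ^+ 2
    <= B * Rintegral mu setT (fun x => cmod (g x) ^+ 2)) ->
  splits_at_heights s (fun xi => cmod (FL mu v f xi)) V B L1high L2low.
Proof.
move=> vL2 V0 vV bes h h0.
exists (fun xi => cmod (FL mu v (high f h) xi)), (fun xi => cmod (FL mu v (low f h) xi)).
have hi xi := cintegrable_pairing_oo (cmeasurable_high h) (vL2 xi).1
  (rintegrable_high h0) (V0 xi) (vV xi).
split.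
- by move=> xi; exact: cmod_ge0.
- move=> xi; apply: le_trans (cmodD _ _).
  rewrite /FL -cinnerD.
  + have -> // : (fun x => high f h x + low f h x) = f.
    by apply/funext => x; rewrite -high_low.
  + exact: (hi xi).1.
  + exact: cintegrable_pairing_L2 (square_integrable_low h) (vL2 xi).
- by move=> xi; exact: (hi xi).2.
- exact: bes (square_integrable_low h).
Qed.

End Heights.

(** * Hoelder interpolation between the two endpoint inequalities *)

Section Final.
Set Implicit Arguments.
Unset Strict Implicit.
Context {R : realType}.

Lemma interpolated_sum {I : eqType} (s : seq I) (a U V phi : I -> R) (p q b C M N : R) :
  1 < p -> p <= 2 -> q = p / (p - 1) -> p <= b <= q ->
  (forall xi, 0 <= a xi) -> (forall xi, 0 < U xi) -> (forall xi, 0 < V xi) ->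
  (forall xi, 0 < phi xi) -> 1 <= C -> 0 < M -> 0 < N ->
  \sum_(xi <- s) a xi `^ p * (phi xi * U xi) `^ (2 - p) <= C * M `^ (2 - p) * N ->
  \sum_(xi <- s) a xi `^ q * V xi `^ (2 - q) <= C * N `^ (q - 1) ->
  (\sum_(xi <- s) (a xi * phi xi `^ (b^-1 - q^-1)) `^ b
      * U xi `^ (1 - b / q) * V xi `^ (1 - b / p)) `^ b^-1
  <= C * M `^ (b^-1 - q^-1) * N `^ p^-1.
Proof.
move=> p1 p2 qE /andP[pb bq] a0 U0 V0 phi0 C1 M0 N0 paley hy.
have p0 : 0 < p by exact: lt_trans ltr01 p1.
have b0 : 0 < b by exact: lt_le_trans pb.
have q0 : 0 < q by exact: lt_le_trans bq.
have pm1 : p - 1 != 0 by rewrite gt_eqF ?subr_gt0.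
have pn0 : p != 0 by rewrite gt_eqF.
have bn0 : b != 0 by rewrite gt_eqF.
have pq : p <= q by exact: le_trans bq.
have [al [be [al0 be0 ab bE]]] : exists al be : R,
    [/\ 0 <= al, 0 <= be, al + be = 1 & b = al * p + be * q].
  (* When p = q the weights cannot be found by dividing by q - p, but then b = p. *)
  have [pq'|pq'] := eqVneq p q.
    exists 1, 0; rewrite addr0 mul0r mul1r addr0; split=> //.
    by apply/eqP; rewrite eq_le pb pq' bq.
  have qp : 0 < q - p by rewrite subr_gt0 lt_neqAle pq'.
  exists ((q - b) / (q - p)), ((b - p) / (q - p)).
  by split; rewrite ?divr_ge0 ?(ltW qp) ?subr_ge0//; field; rewrite gt_eqF.
(* The exponents match because p / q = p - 1 here and q / p = q - 1 in [eV]. *)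
have eU : 1 - b / q = (2 - p) * al.
  have beE : be = 1 - al by rewrite -ab addrC addKr.
  by rewrite bE beE qE; field; rewrite pn0 pm1.
have eV : 1 - b / p = (2 - q) * be.
  have alE : al = 1 - be by rewrite -ab addrK.
  by rewrite bE alE qE; field; rewrite ?pn0 ?pm1.
have ephi : (b^-1 - q^-1) * b = (2 - p) * al by rewrite -eU mulrBl mulVf// mulrC.
have M2 : 0 < M `^ (2 - p) by rewrite powR_gt0.
have Nq : 0 < N `^ (q - 1) by rewrite powR_gt0.
have C0 : 0 < C by exact: lt_le_trans ltr01 C1.
have F0 xi : 0 <= a xi `^ p * (phi xi * U xi) `^ (2 - p) by rewrite mulr_ge0 ?powR_ge0.
have G0 xi : 0 <= a xi `^ q * V xi `^ (2 - q) by rewrite mulr_ge0 ?powR_ge0.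
have X0 : 0 < C * M `^ (2 - p) * N by rewrite !mulr_gt0.
have Y0 : 0 < C * N `^ (q - 1) by rewrite mulr_gt0.
have H := sum_powR_holder F0 G0 X0 Y0 al0 be0 ab paley hy.
have -> : \sum_(xi <- s) (a xi * phi xi `^ (b^-1 - q^-1)) `^ b
      * U xi `^ (1 - b / q) * V xi `^ (1 - b / p) =
   \sum_(xi <- s) (a xi `^ p * (phi xi * U xi) `^ (2 - p)) `^ al
      * (a xi `^ q * V xi `^ (2 - q)) `^ be.
  apply: eq_bigr => xi _.
  rewrite (powRM _ (a0 xi) (powR_ge0 _ _)) -(powRrM (phi xi)) ephi eU eV.
  rewrite (powRM al (powR_ge0 _ _) (powR_ge0 _ _)).
  rewrite (powRM be (powR_ge0 _ _) (powR_ge0 _ _)) -!powRrM.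
  rewrite (powRM _ (ltW (phi0 xi)) (ltW (U0 xi))).
  (* Since [a xi] may be 0, splitting its power relies on the total exponent b being nonzero. *)
  rewrite [in a xi `^ b]bE powRD; last first.
    by rewrite (mulrC al) (mulrC be) in bE; rewrite mulrC (mulrC be) -bE (negbTE bn0).
  by rewrite (mulrC al) (mulrC be); ring.
apply: (le_trans (ge0_ler_powR _ _ _ H)); rewrite ?nnegrE ?invr_ge0 ?(ltW b0)//.
- by apply: sumr_ge0 => xi _; rewrite mulr_ge0 ?powR_ge0.
- by rewrite mulr_ge0 ?powR_ge0.
have -> : (C * M `^ (2 - p) * N) `^ al * (C * N `^ (q - 1)) `^ be =
    C * M `^ ((2 - p) * al) * N `^ (al + (q - 1) * be).
  rewrite (powRM al (ltW (mulr_gt0 C0 M2)) (ltW N0)) (powRM al (ltW C0) (ltW M2)).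
  rewrite (powRM be (ltW C0) (ltW Nq)) -!powRrM powR_split//.
  have CE : C `^ al * C `^ be = C by rewrite -powR_split// ab powRr1// ltW.
  by rewrite -[in RHS]CE; ring.
have CM0 : 0 <= C * M `^ ((2 - p) * al) by rewrite mulr_ge0 ?powR_ge0 ?(ltW C0).
rewrite (powRM _ CM0 (powR_ge0 _ _)) (powRM _ (ltW C0) (powR_ge0 _ _)) -!powRrM.
have -> : (2 - p) * al * b^-1 = b^-1 - q^-1 by rewrite -ephi mulfK.
have -> : (al + (q - 1) * be) * b^-1 = p^-1.
  have -> : al + (q - 1) * be = b / p.
    have -> : be = 1 - al by rewrite -ab addrC addKr.
    have -> : b = al * p + (1 - al) * q by rewrite bE; congr (_ + _ * _); rewrite -ab addrC addKr.
    by rewrite qE; field; rewrite ?pn0 ?pm1.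
  by rewrite mulrAC divff// mul1r.
rewrite ler_wpM2r ?powR_ge0// ler_wpM2r ?powR_ge0//.
(* The remaining claim C^(1/b) <= C holds as C >= 1 and b >= 1. *)
rewrite -[leRHS](powRr1 (ltW C0)) ler_powR// invf_le1//.
by rewrite (le_trans (ltW p1)).
Qed.

End Final.

(** * The Paley and Hausdorff-Young inequalities *)

Section Paley.
Set Implicit Arguments.
Unset Strict Implicit.
Context {d : measure_display} {T : measurableType d} {R : realType}.
Variable mu : {measure set T -> \bar R}.

Lemma esum_le_finite {I : choiceType} (F : I -> R) (X : \bar R) :
  (forall s, uniq s -> ((\sum_(xi <- s) F xi)%:E <= X)%E) ->
  (\esum_(xi in [set: I]) (F xi)%:E <= X)%E.
Proof.
move=> H; apply: ge_ereal_sup => _ [A [fA _] <-].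
by rewrite fsbig_finite// sumEFin H// fset_uniq.
Qed.

Lemma Mphi_ge {I : choiceType} (u : I -> T -> R[i]) (phi : I -> R) :
  (forall xi, (cLnorm mu +oo%E (u xi) < +oo)%E) -> (Mphi mu u phi < +oo)%E ->
  forall s, uniq s -> forall t, 0 < t ->
  t * \sum_(xi <- s | t <= phi xi) fine (cLnorm mu +oo%E (u xi)) ^+ 2
  <= fine (Mphi mu u phi).
Proof.
move=> Loo Mfin s us t t0.
have le : ((t * \sum_(xi <- s | t <= phi xi)
    fine (cLnorm mu +oo%E (u xi)) ^+ 2)%:E <= Mphi mu u phi)%E.
  apply: (@le_trans _ _ (t%:E * \esum_(xi in [set xi | (t <= phi xi)%R])
      (cLnorm mu +oo%E (u xi) * cLnorm mu +oo%E (u xi)))%E); last first.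
    by apply: ereal_sup_ubound; exists t.
  rewrite EFinM lee_pmul2l//; apply: esum_ge.
  exists [set` [seq xi <- s | t <= phi xi]].
    by split; [exact: finite_seq|move=> xi /=; rewrite mem_filter => /andP[]].
  rewrite -fsbig_seq ?filter_uniq// big_filter -sumEFin; apply: lee_sum => xi _.
  by rewrite expr2 EFinM !fineK// ge0_fin_numE ?Loo//; exact: Lnorm_ge0.
rewrite -lee_fin fineK//; rewrite fin_numElt Mfin andbT (lt_le_trans _ le)//.
exact: ltNyr.
Qed.

Lemma hausdorff_young_paley_sum {I : choiceType} (u v : I -> T -> R[i]) (p q K B : R) :
  (forall xi, inLp mu 2%:E (u xi) /\ inLp mu 2%:E (v xi)) ->
  (forall xi, cLnorm mu 2%:E (u xi) = 1%E /\ cLnorm mu 2%:E (v xi) = 1%E) ->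
  (forall xi, (cLnorm mu +oo%E (u xi) < +oo)%E /\ (cLnorm mu +oo%E (v xi) < +oo)%E) ->
  1 < p -> p <= 2 -> q = p / (p - 1) -> 0 < K -> 0 <= B ->
  (forall xi, fine (cLnorm mu +oo%E (v xi)) <= K * fine (cLnorm mu +oo%E (u xi))) ->
  (forall g, square_integrable mu g -> forall s, uniq s ->
    \sum_(xi <- s) cmod (FL mu v g xi) ^+ 2
    <= B * Rintegral mu setT (fun x => cmod (g x) ^+ 2)) ->
  exists2 C : R, 1 <= C &
  forall (phi : I -> R) f s, (forall xi, 0 < phi xi) -> (Mphi mu u phi < +oo)%E ->
  inLp mu p%:E f -> uniq s -> 0 < fine (Mphi mu u phi) ->
  0 < Rintegral mu setT (fun x => cmod (f x) `^ p) ->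
  \sum_(xi <- s) cmod (FL mu v f xi) `^ p
     * (phi xi * fine (cLnorm mu +oo%E (u xi))) `^ (2 - p)
  <= C * fine (Mphi mu u phi) `^ (2 - p) * Rintegral mu setT (fun x => cmod (f x) `^ p)
  /\
  \sum_(xi <- s) cmod (FL mu v f xi) `^ q
     * fine (cLnorm mu +oo%E (v xi)) `^ (2 - q)
  <= C * Rintegral mu setT (fun x => cmod (f x) `^ p) `^ (q - 1).
Proof.
move=> L2 n1 Loo p1 p2 qE K0 B0 VU bes.
have p0 : 0 < p by exact: lt_trans ltr01 p1.
have vL2 xi := (inLp2_square_integrable (L2 xi).2).1.
have U0 xi := cLnorm_oo_gt0 (L2 xi).1 (n1 xi).1 (Loo xi).1.
have V0 xi := cLnorm_oo_gt0 (L2 xi).2 (n1 xi).2 (Loo xi).2.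
have vV xi : \forall x \ae mu, cmod (v xi x) <= fine (cLnorm mu +oo%E (v xi)).
  apply: cLnorm_oo_ae; last exact: (Loo xi).2.
  exact: cLnorm2_measure_gt0 (L2 xi).1.1 (n1 xi).1.
(* At p = 2 the constants [geoC (2 - p)] and [geoC (q - 2)] would invert 0. There the weights have
   exponent 0, and both claims are the Bessel inequality. *)
have [pE|pn2] := eqVneq p 2.
  have q2 : q = 2 by rewrite qE pE; field.
  exists (1 + B); first by rewrite lerDl.
  move=> phi f s phi0 Mfin fLp us M0 N0; rewrite q2 pE !subrr.
  have fL2 : square_integrable mu f.
    by apply: (inLp2_square_integrable _).1; rewrite -pE.
  have E2 : (fun x => cmod (f x) `^ 2) = (fun x => cmod (f x) ^+ 2).
    by apply/funext => x; rewrite powR_mulrn ?cmod_ge0.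
  rewrite pE E2 in N0.
  have le : \sum_(xi <- s) cmod (FL mu v f xi) `^ 2 <=
      (1 + B) * Rintegral mu setT (fun x => cmod (f x) ^+ 2).
    under eq_bigr do rewrite powR_mulrn ?cmod_ge0//.
    by rewrite (le_trans (bes f fL2 s us))// ler_wpM2r ?(ltW N0)// lerDr.
  rewrite E2; split; first by under eq_bigr do rewrite powRr0 mulr1; rewrite powRr0 mulr1.
  under eq_bigr do rewrite powRr0 mulr1.
  by rewrite (_ : 2 - 1 = 1 :> R) ?powRr1 ?(ltW N0)//; ring.
have p2' : p < 2 by rewrite lt_neqAle pn2.
set C1 := 2 `^ p * (32 * K * geoC (p - 1) + 4 * B * geoC (2 - p)).
set C2 := 2 `^ q * (4 * B * 8 `^ (q - 2) * geoC (q - 2)).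
exists (Num.max 1 (Num.max C1 C2)); first by rewrite le_max lexx.
move=> phi f s phi0 Mfin fLp us M0 N0.
have If := (inLp_rintegrable p0 fLp).1.
have split := FL_splits p1 p2 fLp.1 If vL2 (fun xi => ltW (V0 xi)) vV
  (fun g gL2 => bes g gL2 s us).
set N := Rintegral _ _ _ in N0 *.
have q0 : 0 < q by rewrite qE divr_gt0// subr_gt0.
split.
  apply: (@le_trans _ _ (C1 * fine (Mphi mu u phi) `^ (2 - p) * N)).
    apply: (paley_sum p1 (fun xi => cmod_ge0 _) U0 phi0 K0 VU M0 _ B0 split).
    - exact: (Mphi_ge (fun xi => (Loo xi).1) Mfin us).
    - by move=> h; exact: L1high_ge0.
    - by move=> l n l0; exact: (sum_L1high p1 fLp.1 If n l0).
    - by move=> l n l0; exact: (sum_L2low p1 p2 fLp.1 If n p2' l0).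
  rewrite ler_wpM2r ?(ltW N0)// ler_wpM2r ?powR_ge0//.
  by rewrite !le_max lexx orbT.
apply: (@le_trans _ _ (C2 * N `^ (q - 1))).
  apply: (hausdorff_young_sum p1 q0 (fun xi => cmod_ge0 _) V0 N0 B0 split).
  - by move=> h h0; exact: (L1high_le p1 fLp.1 If h0).
  - by move=> l n l0; exact: (sum_L2low_conjugate p1 p2 fLp.1 If n p2' qE l0).
by rewrite ler_wpM2r ?powR_ge0// !le_max lexx !orbT.
Qed.

(** Cut f at height 1: both pieces have zero norm, so the L^1 pairing bound and the Bessel
    inequality for a single index annihilate their coefficients. *)
Lemma FL_eq0 {I : choiceType} (v : I -> T -> R[i]) (p B : R) (f : T -> R[i]) xi :
  inLp mu 2%:E (v xi) -> cLnorm mu 2%:E (v xi) = 1%E ->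
  (cLnorm mu +oo%E (v xi) < +oo)%E -> 1 < p -> p <= 2 -> 0 <= B ->
  (forall g, square_integrable mu g -> forall s, uniq s ->
    \sum_(xi <- s) cmod (FL mu v g xi) ^+ 2
    <= B * Rintegral mu setT (fun x => cmod (g x) ^+ 2)) ->
  inLp mu p%:E f -> Rintegral mu setT (fun x => cmod (f x) `^ p) = 0 ->
  cmod (FL mu v f xi) = 0.
Proof.
move=> vLp v1 vfin p1 p2 B0 bes fLp N0.
have If := (inLp_rintegrable (lt_trans ltr01 p1) fLp).1.
have V0 := cLnorm_oo_gt0 vLp v1 vfin.
have vL2 := (inLp2_square_integrable vLp).1.
have vV := cLnorm_oo_ae (cLnorm2_measure_gt0 vLp.1 v1) vfin.
have [ci hi] := cintegrable_pairing_oo (cmeasurable_high fLp.1 1) vLp.1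
  (rintegrable_high p1 fLp.1 If ltr01) (ltW V0) vV.
have L1 : L1high mu f 1 <= 0.
  by have := L1high_le p1 fLp.1 If ltr01; rewrite N0 mulr0.
have L2 : L2low mu f 1 <= 0.
  by have := L2low_le p1 p2 fLp.1 If 1; rewrite N0 mulr0.
have lowL2 := square_integrable_low p1 p2 fLp.1 If 1.
have lo : cmod (FL mu v (low f 1) xi) ^+ 2 <= 0.
  have := bes _ lowL2 [:: xi] isT; rewrite big_seq1 => /le_trans; apply.
  by rewrite mulr_ge0_le0.
have lo0 : cmod (FL mu v (low f 1) xi) = 0.
  by apply/eqP; rewrite -sqrf_eq0 eq_le lo sqr_ge0.
apply/eqP; rewrite eq_le cmod_ge0 andbT.
have -> : FL mu v f xi = cinner mu (high f 1) (v xi) + cinner mu (low f 1) (v xi).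
  rewrite -cinnerD//; last exact: cintegrable_pairing_L2.
  by congr cinner; apply/funext => x; exact: high_low.
rewrite (le_trans (cmodD _ _))// -[cmod (cinner mu (low f 1) _)]/(cmod (FL mu v _ xi)).
rewrite lo0 addr0 (le_trans hi)// mulr_ge0_le0// mulr_ge0//.
exact: ltW.
Qed.

End Paley.

Theorem mainTheorem7 (d : measure_display) (T : measurableType d) (R : realType)
  (mu : {measure set T -> \bar R}) (I : choiceType)
  (u v : I -> T -> R[i]) :
  sigma_finite setT mu ->
  (forall xi, inLp mu 2%:E (u xi) /\ inLp mu 2%:E (v xi)) ->
  (forall xi, cLnorm mu 2%:E (u xi) = 1%E /\ cLnorm mu 2%:E (v xi) = 1%E) ->
  (forall xi eta, cinner mu (u xi) (v eta) = (if xi == eta then 1 else 0)) ->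
  riesz_basis mu u ->
  (forall xi, (cLnorm mu +oo%E (u xi) < +oo)%E /\ (cLnorm mu +oo%E (v xi) < +oo)%E) ->
  forall p : R, 1 < p <= 2 ->
  let p' := p / (p - 1) in
  (exists K : R, forall xi,
     fine (cLnorm mu +oo%E (v xi)) / fine (cLnorm mu +oo%E (u xi)) <= K) ->
  exists C : R, 0 < C /\
  forall b : R, p <= b <= p' ->
  forall phi : I -> R, (forall xi, 0 < phi xi) ->
  (Mphi mu u phi < +oo)%E ->
  forall f : T -> R[i], inLp mu p%:E f ->
  ((\esum_(xi in [set: I])
      (((cmod (FL mu v f xi) * phi xi `^ (b^-1 - p'^-1)) `^ b
        * fine (cLnorm mu +oo%E (u xi)) `^ (1 - b / p')
        * fine (cLnorm mu +oo%E (v xi)) `^ (1 - b / p))%:E)) `^ b^-1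
   <= (C * fine (Mphi mu u phi) `^ (b^-1 - p'^-1))%:E * cLnorm mu p%:E f)%E.
Proof.
move=> _ L2 n1 biorth riesz Loo p /andP[p1 p2] p' [K0 HK].
have [B B0 bes] := bessel L2 (fun xi => (n1 xi).2) biorth riesz.
have p0 : 0 < p by exact: lt_trans ltr01 p1.
have U0 xi := cLnorm_oo_gt0 (L2 xi).1 (n1 xi).1 (Loo xi).1.
have V0 xi := cLnorm_oo_gt0 (L2 xi).2 (n1 xi).2 (Loo xi).2.
(* [K0] comes without a sign when [I] is empty, so it is replaced by a positive bound. *)
have K1 : 0 < Num.max 1 K0 by rewrite lt_max ltr01.
have VU xi : fine (cLnorm mu +oo%E (v xi)) <= Num.max 1 K0 * fine (cLnorm mu +oo%E (u xi)).
  by rewrite -ler_pdivrMr// (le_trans (HK xi))// le_max lexx orbT.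
have [C C1 HC] := hausdorff_young_paley_sum L2 n1 Loo p1 p2 erefl K1 B0 VU bes.
have C0 : 0 < C by exact: lt_le_trans ltr01 C1.
exists C; split=> // b pbq phi phi0 Mfin f fLp.
have /andP[pb bq] := pbq.
have b0 : 0 < b by exact: lt_le_trans pb.
have [If ->] := inLp_rintegrable p0 fLp.
rewrite -EFinM; set N := Rintegral _ _ _; set X := (X in (_ <= X%:E)%E).
have N0 : 0 <= N by apply: Rintegral_ge0 => x _; exact: powR_ge0.
have X0 : 0 <= X by rewrite !mulr_ge0 ?powR_ge0// ltW.
set F := fun xi => (cmod (FL mu v f xi) * phi xi `^ (b^-1 - p'^-1)) `^ b
  * fine (cLnorm mu +oo%E (u xi)) `^ (1 - b / p')
  * fine (cLnorm mu +oo%E (v xi)) `^ (1 - b / p).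
have F0 xi : 0 <= F xi by rewrite !mulr_ge0 ?powR_ge0.
have key s : uniq s -> (\sum_(xi <- s) F xi) `^ b^-1 <= X.
  case: s => [|xi0 s] us; first by rewrite big_nil powR0// invr_neq0// gt_eqF.
  have [N00|Nn0] := eqVneq N 0.
    rewrite big1 ?powR0 ?invr_neq0 ?gt_eqF// => xi _.
    rewrite /F (FL_eq0 (L2 xi).2 (n1 xi).2 (Loo xi).2 p1 p2 B0 bes fLp N00).
    by rewrite mul0r powR0 ?gt_eqF// !mul0r.
  have Np : 0 < N by rewrite lt_def Nn0.
  (* Positivity needs an index, which is why the empty list was set aside: t = phi xi0 keeps the
     term of xi0 in the supremum. *)
  have Mp : 0 < fine (Mphi mu u phi).
    have := Mphi_ge (fun xi => (Loo xi).1) Mfin (isT : uniq [:: xi0]) (phi0 xi0).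
    rewrite big_cons lexx big_nil addr0; apply: lt_le_trans.
    by rewrite mulr_gt0// exprn_gt0.
  have [paley hy] := HC phi f _ phi0 Mfin fLp us Mp Np.
  exact: (interpolated_sum p1 p2 erefl pbq (fun xi => cmod_ge0 _) U0 V0 phi0 C1 Mp Np).
(* The root is removed so that the bound passes to the supremum over finite sums; it is restored at
   the end by monotonicity. *)
have sum_le s : uniq s -> \sum_(xi <- s) F xi <= X `^ b.
  move=> us; have S0 : 0 <= \sum_(xi <- s) F xi by apply: sumr_ge0.
  have := ge0_ler_powR (ltW b0) _ _ (key s us).
  rewrite !nnegrE powR_ge0 X0 -powRrM mulVf ?gt_eqF// powRr1//.
  exact.
have esum_le : (\esum_(xi in [set: I]) (F xi)%:E <= (X `^ b)%:E)%E.
  by apply: esum_le_finite => s us; rewrite lee_fin sum_le.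
have esum0 : (0 <= \esum_(xi in [set: I]) (F xi)%:E)%E.
  by apply: esum_ge0 => xi _; rewrite lee_fin.
have -> : X%:E = ((X `^ b)%:E `^ b^-1)%E.
  by rewrite poweR_EFin -powRrM divff ?gt_eqF// powRr1.
apply: gt0_ler_poweR => //; rewrite ?invr_ge0 ?(ltW b0)//.
- by rewrite in_itv/= esum0 leey.
- by rewrite in_itv/= lee_fin powR_ge0 leey.
Qed.
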